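(* Let $G$ be a finite simple planar graph such that every 5-cycle $C$ of $G$ satisfies both of the following: (i) $C$ is not contained in a subgraph of $G$ isomorphic to the 5-wheel, and (ii) $C$ does not share exactly one edge with a 3-cycle of $G$. Then $G$ is 4-choosable.
   Context: A list assignment $L$ for a graph $G$ assigns to each vertex $v$ a set $L(v)$ of colors; it is a $k$-assignment if $|L(v)|=k$ for all $v$. $G$ is $L$-colorable if one can choose $c(v)\in L(v)$ for every $v$ with $c(u)\neq c(v)$ for every edge $uv$. $G$ is $k$-choosable if it is $L$-colorable for every $k$-assignment $L$. The 5-wheel is the graph obtained from a 5-cycle by adding one new vertex adjacent to all five vertices of the cycle; ''$C$ is a subgraph of a 5-wheel'' means $C$ is the rim 5-cycle or any 5-cycle of such a subgraph of $G$ (i.e., $C$ lies in some subgraph of $G$ isomorphic to the 5-wheel). *)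

(* Defs.v *)
From HB Require Import structures.
From mathcomp Require Import all_boot all_order all_algebra.
From mathcomp Require Import all_classical all_reals all_analysis.

Set Implicit Arguments.
Unset Strict Implicit.
Unset Printing Implicit Defensive.

Import Order.TTheory GRing.Theory Num.Theory.
Import numFieldNormedType.Exports.

Local Open Scope ring_scope.

(* The edge uv is drawn as a simple arc, parametrized from u to v by arc u v
   and from v to u by arc v u; values of arc u v outside [0, 1], or for
   non-adjacent u and v, are irrelevant. *)
Definition plane_drawing (R : realType) (V : finType) (e : rel V)
    (pos : V -> R * R) (arc : V -> V -> R -> R * R) : Prop :=
  [/\ injective pos,
      forall u v, e u v ->
        [/\ {within `[0, 1]%classic, continuous (arc u v)}%classic,
            {in `[0, 1] &, injective (arc u v)},
            arc u v 0 = pos u,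
            arc u v 1 = pos v
          & forall t : R, t \in `[0, 1] -> arc v u t = arc u v (1 - t)],
      forall u v w (t : R), e u v -> t \in `]0, 1[ -> arc u v t <> pos w
    & forall u v u' v' (s t : R), e u v -> e u' v' ->
        [set u; v] <> [set u'; v'] ->
        s \in `]0, 1[ -> t \in `]0, 1[ -> arc u v s <> arc u' v' t].

Definition planar (R : realType) (V : finType) (e : rel V) : Prop :=
  exists (pos : V -> R * R) (arc : V -> V -> R -> R * R),
    plane_drawing e pos arc.

Local Close Scope ring_scope.

(* Only meaningful for k >= 3: an edge traversed back and forth satisfies it for
   k = 2. *)
Definition is_kcycle (V : finType) (e : rel V) (k : nat) (c : seq V) : bool :=
  (size c == k) && ucycleb e c.

Definition cycle_edges (V : finType) (c : seq V) : {set {set V}} :=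
  [set [set x; next c x] | x in c].

(* None is the hub, Some i are the rim vertices in cyclic order. *)
Definition wheel5 : rel (option 'I_5) := fun x y =>
  match x, y with
  | Some i, Some j => (j == ordS i) || (i == ordS j)
  | None, None => false
  | _, _ => true
  end.

(* A subgraph isomorphic to the 5-wheel (not necessarily induced) is the image
   of an injective homomorphism f. *)
Definition in_wheel5 (V : finType) (e : rel V) (c : seq V) : Prop :=
  exists f : option 'I_5 -> V,
    [/\ injective f,
        forall x y, wheel5 x y -> e (f x) (f y)
      & cycle_edges c \subset
          [set [set f p.1; f p.2] | p : option 'I_5 * option 'I_5
                                    & wheel5 p.1 p.2]].

Definition L_colorable (V : finType) (e : rel V) (C : finType)
    (L : V -> {set C}) : Prop :=
  exists c : V -> C,
    (forall v, c v \in L v) /\ (forall u v, e u v -> c u <> c v).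

(* As V is finite, only finitely many colors occur in the lists, so letting the
   palette range over all finite types loses no generality. *)
Definition choosable (V : finType) (e : rel V) (k : nat) : Prop :=
  forall (C : finType) (L : V -> {set C}),
    (forall v, #|L v| = k) -> L_colorable e L.

(* Main.v *)
(* Take a vertex-critical counterexample for lists of size 4. An oriented bipartite
   digraph is kernel-perfect, so no nonempty induced bipartite subgraph S can be
   oriented so that each v in S has in-degree at least d(v) - 3 within S. Hence all
   degrees are at least 4, a chordless 4-cycle has a vertex of degree at least 5
   (is not all "low"), and two configurations of two or three consecutive 4-faces
   around a vertex of degree 5 are excluded.

   Forbidding a 5-cycle that shares exactly one edge with a triangle makes every
   3-face adjacent to at most one 3-face and to no 5-face, a pair of adjacent
   3-faces adjacent to no 4-face, and every 4-face adjacent to at most one 3-face.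
   Give each vertex v the charge 6(d(v) - 4) and each face f the charge 6(|f| - 4);
   the total is negative. A 3-face needs 2 for each of its sides: it gets this from
   a face of length at least 6 across the side, or from the vertices of degree at
   least 5 on a 4-face across the side; if a 3-face lies across, each end of the
   common edge supplies 1 to either 3-face, taken from the end itself when its
   degree is at least 5 and otherwise from the faces of length at least 6 on both
   sides of the remaining edge at that end. The total is then nonnegative.

   Euler's inequality is obtained without the Jordan curve theorem. Covering the
   thirds of the arcs by small squares exhibits the graph as a minor of the square
   grid. In the grid every edge set with even degrees is the boundary of a set of
   faces, by counting the vertical edges on the left of a face modulo 2; this
   property survives deletions and contractions of rotation systems, and comparing
   the number of even edge sets with the number of sets of faces gives
   E + 1 <= V + F. *)

From mathcomp Require Import all_boot zify.

Set Implicit Arguments.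
Unset Strict Implicit.
Unset Printing Implicit Defensive.

(** * Colouring reducible configurations *)

Section BipartiteKernel.
Variable V : finType.

(** Induction on the size of S. A sink s is added to a kernel of what remains after deleting s and
    its in-neighbours. If there is no sink, the part of S in the class X is a kernel: every vertex
    outside X has an out-neighbour, which then lies in X. *)
Lemma bipartite_kernel (a : rel V) (X : pred V) (S : {set V}) :
    {in S &, forall u v, a u v -> X u != X v} ->
  exists K : {set V},
    [/\ K \subset S, {in K &, forall u v, ~~ a u v}
      & {in S :\: K, forall u, exists2 v, v \in K & a u v}].
Proof.
have [n] := ubnP #|S|; elim: n S => // n IHn S leSn bipS.
case: (pickP [pred s in S | [forall v in S, ~~ a s v]]) => [s | no_sink]; last first.
  exists [set u in S | X u]; split.
  - by apply/subsetP => u; rewrite inE => /andP[].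
  - move=> u v; rewrite !inE => /andP[uS Xu] /andP[vS Xv]; apply/negP => auv.
    by have := bipS _ _ uS vS auv; rewrite Xu Xv.
  - move=> u; rewrite !inE => /andP[]; have [uS /= nXu _ | //] := boolP (u \in S).
    have := no_sink u; rewrite /= uS /= => /negbT; rewrite negb_forall => /existsP[v].
    rewrite negb_imply negbK => /andP[vS auv]; exists v => //.
    by rewrite inE vS; have := bipS _ _ uS vS auv; rewrite (negbTE nXu); case: (X v).
case/andP => sS /forall_inP sinks.
pose S' := [set u in S | (u != s) && ~~ a u s].
have sS'S : S' \subset S by apply/subsetP => u; rewrite inE => /andP[].
have ltS' : #|S'| < n.
  rewrite -ltnS (leq_trans _ leSn)// ltnS proper_card//; apply/properP; split => //.
  by exists s => //; rewrite inE sS eqxx.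
have [|K [KS indK absK]] := IHn S' ltS'.
  by move=> u v uS vS; apply: bipS; apply: (subsetP sS'S).
exists (s |: K); split.
- by rewrite subUset sub1set sS (subset_trans KS).
- move=> u v; rewrite !inE => /predU1P[->|uK] /predU1P[->|vK].
  + exact: sinks.
  + by apply: sinks; have := subsetP KS _ vK; rewrite inE => /andP[].
  + by have := subsetP KS _ uK; rewrite inE => /and3P[].
  + exact: indK.
- move=> u; rewrite !inE negb_or => /andP[/andP[us uK] uS].
  have [aus | naus] := boolP (a u s); first by exists s; rewrite // !inE eqxx.
  have [|v vK auv] := absK u; first by rewrite !inE uK uS us.
  by exists v; rewrite // !inE vK orbT.
Qed.

(* Galvin's argument: colour a kernel of the vertices whose list contains a
   given colour, and recurse on the rest. *)
Lemma bipartite_list_coloring (C : finType) (a : rel V) (X : pred V)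
    (c0 : V -> C) (S : {set V}) (L : V -> {set C}) :
    {in S &, forall u v, a u v -> X u != X v} ->
    {in S, forall u, #|[set v in S | a u v]| < #|L u|} ->
  exists c : V -> C, {in S, forall u, c u \in L u} /\
    {in S &, forall u v, a u v -> c u != c v}.
Proof.
have [n] := ubnP #|S|; elim: n S L => // n IHn S L leSn bipS outS.
have [->|[v vS]] := set_0Vmem S; first by exists c0; split => u; rewrite ?inE.
have [x xL] : exists x, x \in L v.
  by apply/card_gt0P; apply: leq_ltn_trans (outS v vS).
pose Sx := [set u in S | x \in L u].
have SxS : Sx \subset S by apply/subsetP => u; rewrite inE => /andP[].
have [|K [KSx indK absK]] := @bipartite_kernel a X Sx.
  by move=> u w uS wS; apply: bipS; apply: (subsetP SxS).
have [k kK] : exists k, k \in K.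
  have [vK|vK] := boolP (v \in K); first by exists v.
  have [|k kK _] := absK v; first by rewrite !inE vK vS xL.
  by exists k.
have KS : K \subset S by apply: subset_trans SxS.
have DS u : (u \in S :\: K) -> u \in S by rewrite inE => /andP[].
have [|||c [cL cP]] := IHn (S :\: K) (fun u => L u :\ x).
- rewrite -ltnS (leq_trans _ leSn)// ltnS proper_card//; apply/properP.
  split; first exact: subsetDl.
  by exists k; rewrite ?inE ?kK //; apply: (subsetP KS).
- by move=> u w /DS uS /DS wS; apply: bipS.
- move=> u uSK; have uS := DS _ uSK.
  have sub : [set w in S :\: K | a u w] \subset [set w in S | a u w].
    by apply/subsetP => w; rewrite !inE => /andP[/andP[_ ->] ->].
  have [xu|xu] := boolP (x \in L u); last first.
    rewrite (leq_ltn_trans (subset_leq_card sub))// (leq_trans (outS u uS))//.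
    apply/subset_leq_card/subsetP => y yL; rewrite !inE yL andbT.
    by apply: contraNneq xu => <-.
  (* A vertex that loses the colour x from its list also loses an out-neighbour, the w in K, so the
     strict inequality is kept. *)
  have [|w wK auw] := absK u.
    by move: uSK; rewrite !inE => /andP[-> ->].
  have := outS u uS; rewrite (cardsD1 x (L u)) xu add1n ltnS.
  apply: leq_trans; apply: proper_card; apply/properP; split => //.
  by exists w; rewrite !inE ?wK ?auw ?(subsetP KS _ wK).
exists (fun u => if u \in K then x else c u); split.
- move=> u uS; case: ifPn => uK.
    by have := subsetP KSx _ uK; rewrite inE => /andP[].
  by have := cL u; rewrite !inE uK uS => /(_ isT)/andP[].
move=> u w uS wS auw; case: ifPn => uK; case: ifPn => wK.
- by rewrite (negbTE (indK _ _ uK wK)) in auw.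
- by have := cL w; rewrite !inE wK wS => /(_ isT)/andP[]; rewrite eq_sym.
- by have := cL u; rewrite !inE uK uS => /(_ isT)/andP[].
- by apply: cP; rewrite // inE ?uK ?wK.
Qed.

End BipartiteKernel.

Section Reducible.
Variables (V : finType) (e : rel V) (C : finType) (L : V -> {set C}).
Hypotheses (e_sym : symmetric e) (L4 : forall v, #|L v| = 4).

Definition colorable_on (W : {set V}) : Prop :=
  exists c : V -> C, {in W, forall v, c v \in L v} /\
    {in W &, forall u v, e u v -> c u != c v}.

Definition deg (v : V) := #|[set w | e v w]|.

Hypotheses (not_col : ~ colorable_on setT)
  (crit : forall W : {set V}, W != setT -> colorable_on W).

(** Colour the complement of S by criticality. A vertex v of S keeps at least 4 minus the number of
    its outer neighbours as available colours. If every in-degree in S were at least [deg v - 3],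
    every out-degree would be below that number, and the kernel argument would extend the colouring
    to S. *)
Lemma oriented_bipartite_irreducible (S : {set V}) (b : rel V) (X : pred V) :
    S != set0 ->
    {in S &, forall u v, e u v -> X u != X v} ->
    {in S &, forall u v, b u v -> e u v && ~~ b v u} ->
  exists2 v, v \in S & 3 + #|[set u in S | b u v]| < deg v.
Proof.
move=> S0 bipS bS; apply/exists_inP; apply: contra_notT not_col.
rewrite negb_exists_in => /forall_inP small.
have [|c1 [c1L c1P]] := crit (W := ~: S).
  by apply: contra S0 => /eqP SC; rewrite -[S]setCK SC setCT.
pose L' v := [set x in L v | [forall w in ~: S, e v w ==> (c1 w != x)]].
(* Edges that [b] leaves undirected are directed away from the class X, so [a] orients all edges
   inside S and no in-neighbour under [b] is an out-neighbour under [a]. *)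
pose a u v := e u v && (b u v || ~~ b v u && X u).
have [||c [cL cP]] := @bipartite_list_coloring V C a X c1 S L'.
- by move=> u v uS vS /andP[euv _]; apply: bipS.
- move=> v vS.
  have dS : #|[set w | e v w]| = #|[set w in S | e v w]| + #|[set w in ~: S | e v w]|.
    rewrite -(cardsID S [set w | e v w]); congr (_ + _); apply: eq_card => w;
    by rewrite !inE // andbC.
  have ab : #|[set w in S | a v w]| + #|[set w in S | b w v]| <= #|[set w in S | e v w]|.
    have dis : [disjoint [set w in S | a v w] & [set w in S | b w v]].
      rewrite -setI_eq0; apply/eqP/setP => w; rewrite !inE; apply/negbTE.
      apply/negP => /andP[/andP[wS /andP[evw avw]] /andP[_ bwv]].
      case/orP: avw => [bvw|]; last by rewrite bwv.
      by have /andP[_] := bS _ _ vS wS bvw; rewrite bwv.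
    have [_] := leq_card_setU [set w in S | a v w] [set w in S | b w v].
    rewrite dis => /eqP <-; apply/subset_leq_card/subsetP => w.
    rewrite !inE => /orP[/andP[-> /andP[]]//|/andP[wS bwv]]; rewrite wS.
    by have /andP[] := bS _ _ wS vS bwv; rewrite e_sym.
  have LL : #|L v| <= #|L' v| + #|[set w in ~: S | e v w]|.
    rewrite -(cardsID (L' v) (L v)) leq_add//.
      by apply/subset_leq_card/subsetP => x; rewrite !inE => /andP[].
    apply: leq_trans (leq_imset_card c1 _).
    apply/subset_leq_card/subsetP => x; rewrite 2!inE => /andP[xL' xL].
    move: xL'; rewrite xL /= => /forall_inPn[w wS]; rewrite negb_imply negbK.
    by move=> /andP[evw /eqP <-]; apply: imset_f; rewrite inE wS.
  have := small v vS; rewrite -leqNgt /deg dS => le3.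
  rewrite L4 in LL.
  rewrite -(ltn_add2r (#|[set w in S | b w v]| + #|[set w in ~: S | e v w]|)).
  rewrite addnA (leq_ltn_trans (leq_add ab (leqnn _)))//.
  rewrite (leq_ltn_trans le3)// addnCA -addSn addnC leq_add2l.
  exact: LL.
exists (fun v => if v \in S then c v else c1 v); split.
- move=> v _; case: ifPn => vS; first by have := cL v vS; rewrite inE => /andP[].
  by apply: c1L; rewrite inE.
have mixed u v : u \in S -> v \notin S -> e u v -> c u != c1 v.
  move=> uS vS euv; have := cL u uS; rewrite inE => /andP[_ /forall_inP/(_ v)].
  by rewrite inE vS euv eq_sym; apply.
move=> u v _ _ euv; case: ifPn => uS; case: ifPn => vS.
- have Xuv := bipS _ _ uS vS euv.
  have /orP[] : a u v || a v u.
    rewrite /a euv e_sym euv /=; move: Xuv.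
    by case: (b u v); case: (b v u); case: (X u); case: (X v).
  - exact: cP.
  - by rewrite eq_sym; apply: cP.
- exact: mixed.
- by rewrite eq_sym; apply: mixed; rewrite // e_sym.
- by apply: c1P; rewrite ?inE.
Qed.

Hypothesis e_irr : irreflexive e.

(* Arcs are given by index pairs: (i, j) in ab stands for A_i -> B_j, and
   (i, j) in ba for B_j -> A_i. *)
Lemma oriented_config_irreducible (x0 : V) (A B : seq V) (ab ba : seq (nat * nat)) :
    uniq (A ++ B) -> 0 < size (A ++ B) ->
    pairwise (fun u v => ~~ e u v) A -> pairwise (fun u v => ~~ e u v) B ->
    uniq (ab ++ ba) ->
    {in ab ++ ba, forall p,
      [&& p.1 < size A, p.2 < size B & e (nth x0 A p.1) (nth x0 B p.2)]} ->
    (forall i, i < size A ->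
       deg (nth x0 A i) <= 3 + count (fun p => p.1 == i) ba) ->
    (forall j, j < size B ->
       deg (nth x0 B j) <= 3 + count (fun p => p.2 == j) ab) ->
  False.
Proof.
rewrite !cat_uniq => /and3P[uA AB uB] s0 pA pB /and3P[uab dab uba] earc dA dB.
have notB v : v \in A -> v \notin B.
  by move=> vA; apply: contra AB => vB; apply/hasP; exists v.
pose S := [set x in A ++ B].
pose b u v := (u \in A) && (v \in B) && ((index u A, index v B) \in ab)
   || (u \in B) && (v \in A) && ((index v A, index u B) \in ba).
have pairE s u v : pairwise (fun u v => ~~ e u v) s -> u \in s -> v \in s -> ~~ e u v.
  move=> ps us vs; have [->|uv] := eqVneq u v; first by rewrite e_irr.
  move: ps => /(pairwiseP x0) ps.
  have iu : index u s \in gtn (size s) by rewrite inE index_mem.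
  have iv : index v s \in gtn (size s) by rewrite inE index_mem.
  have [lt|lt|eq] := ltngtP (index u s) (index v s).
  - by have := ps _ _ iu iv lt; rewrite !nth_index.
  - by have := ps _ _ iv iu lt; rewrite !nth_index // e_sym.
  - by case/eqP: uv; rewrite -(nth_index x0 us) eq nth_index.
have [|||v] := @oriented_bipartite_irreducible S b (mem A).
- by apply/set0Pn; exists (nth x0 (A ++ B) 0); rewrite inE mem_nth.
- move=> u v; rewrite !inE !mem_cat => uS vS euv.
  case uA' : (u \in A); case vA : (v \in A) => //.
    by have := pairE _ _ _ pA uA' vA; rewrite euv.
  by move: uS vS; rewrite uA' vA /= => uB' vB; have := pairE _ _ _ pB uB' vB; rewrite euv.
- move=> u v _ _ /orP[] /andP[/andP[u1 v1] arc].
    have /and3P[_ _] := earc _ (etrans (mem_cat _ _ _) (introT orP (or_introl arc))).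
    rewrite /= !nth_index // => ->; rewrite /b (negbTE (notB _ u1)) andbF u1 v1 /=.
    by apply: contra dab => arc'; apply/hasP; exists (index u A, index v B).
  have /and3P[_ _] := earc _ (etrans (mem_cat _ _ _) (introT orP (or_intror arc))).
  rewrite /= !nth_index // e_sym => ->; rewrite /b (negbTE (notB _ v1)) u1 v1 /= orbF.
  by apply: contra dab => arc'; apply/hasP; exists (index v A, index u B).
rewrite inE mem_cat => /orP[] vS; apply/negP; rewrite -leqNgt.
  have := dA (index v A); rewrite index_mem nth_index // => /(_ vS)/leq_trans; apply.
  (* Distinct arcs into v start at distinct vertices, so the number of index pairs bounds the
     in-degree from below. *)
  rewrite leq_add2l -size_filter -(size_map (fun p => nth x0 B p.2)) .
  rewrite -(card_uniqP _); last first.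
    rewrite map_inj_in_uniq ?filter_uniq// => -[i j] [i' j'].
    rewrite !mem_filter /= => /andP[/eqP-> p1] /andP[/eqP-> p2] eqn.
    congr (_, _); apply/eqP.
    have /and3P[_ /= j1 _] := earc _ (etrans (mem_cat _ _ _) (introT orP (or_intror p1))).
    have /and3P[_ /= j2 _] := earc _ (etrans (mem_cat _ _ _) (introT orP (or_intror p2))).
    by rewrite -(nth_uniq x0 j1 j2 uB) eqn.
  apply/subset_leq_card/subsetP => u /mapP[[i j]].
  rewrite mem_filter /= => /andP[/eqP-> p1 ->].
  have /and3P[_ /= j1 _] := earc _ (etrans (mem_cat _ _ _) (introT orP (or_intror p1))).
  by rewrite !inE mem_cat /b mem_nth // orbT vS index_uniq // p1 orbT.
have := dB (index v B); rewrite index_mem nth_index // => /(_ vS)/leq_trans; apply.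
rewrite leq_add2l -size_filter -(size_map (fun p => nth x0 A p.1)) .
rewrite -(card_uniqP _); last first.
  rewrite map_inj_in_uniq ?filter_uniq// => -[i j] [i' j'].
  rewrite !mem_filter /= => /andP[/eqP-> p1] /andP[/eqP-> p2] eqn.
  congr (_, _); apply/eqP.
  have /and3P[/= j1 _ _] := earc _ (etrans (mem_cat _ _ _) (introT orP (or_introl p1))).
  have /and3P[/= j2 _ _] := earc _ (etrans (mem_cat _ _ _) (introT orP (or_introl p2))).
  by rewrite -(nth_uniq x0 j1 j2 uA) eqn.
apply/subset_leq_card/subsetP => u /mapP[[i j]].
rewrite mem_filter /= => /andP[/eqP-> p1 ->].
have /and3P[/= j1 _ _] := earc _ (etrans (mem_cat _ _ _) (introT orP (or_introl p1))).
by rewrite !inE mem_cat /b mem_nth //= vS index_uniq // p1.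
Qed.

End Reducible.

(** * Rotation systems and small faces *)

Section CyclicLists.
Variable T : eqType.

Lemma next_prefix4 (x a b c : T) s : uniq [:: x, a, b, c & s] ->
  let p := [:: x, a, b, c & s] in [/\ next p x = a, next p a = b & next p b = c].
Proof.
rewrite /= !inE !negb_or => /and5P[/and4P[xa xb xc _] /and3P[ab ac _] /andP[bc _] _ _].
by rewrite !eqxx ?(eq_sym a x) ?(eq_sym b x) ?(eq_sym b a) (negbTE xa) (negbTE xb) (negbTE ab).
Qed.

Lemma next_cycle4 (x a b c : T) : uniq [:: x; a; b; c] ->
  let p := [:: x; a; b; c] in
  [/\ next p x = a, next p a = b, next p b = c & next p c = x].
Proof.
rewrite /= !inE !negb_or => /and4P[/and3P[xa xb xc] /andP[ab ac] bc _].
by rewrite !eqxx ?(eq_sym a x) ?(eq_sym b x) ?(eq_sym c x)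
  ?(eq_sym b a) ?(eq_sym c a) ?(eq_sym c b)
  (negbTE xa) (negbTE xb) (negbTE ab) (negbTE xc) (negbTE ac) (negbTE bc).
Qed.

Lemma next_cycle5 (x a b c d : T) : uniq [:: x; a; b; c; d] ->
  let p := [:: x; a; b; c; d] in
  [/\ next p x = a, next p a = b, next p b = c, next p c = d & next p d = x].
Proof.
rewrite /= !inE !negb_or => /and5P[/and4P[xa xb xc xd] /and3P[ab ac ad] /andP[bc bd] cd _].
by rewrite !eqxx ?(eq_sym a x) ?(eq_sym b x) ?(eq_sym c x) ?(eq_sym d x)
  ?(eq_sym b a) ?(eq_sym c a) ?(eq_sym d a) ?(eq_sym c b) ?(eq_sym d b) ?(eq_sym d c)
  (negbTE xa) (negbTE xb) (negbTE ab) (negbTE xc) (negbTE ac)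
  (negbTE bc) (negbTE xd) (negbTE ad) (negbTE bd) (negbTE cd).
Qed.

End CyclicLists.

Section Rotation.
Variables (V : finType) (e : rel V) (rot : V -> seq V).
Hypotheses (rot_uniq : forall v, uniq (rot v)) (rot_mem : forall v w, (w \in rot v) = e v w).

Definition rho (v : V) := next (rot v).
Definition rho' (v : V) := prev (rot v).

Lemma rhoK v : cancel (rho v) (rho' v). Proof. exact: prev_next. Qed.
Lemma rho'K v : cancel (rho' v) (rho v). Proof. exact: next_prev. Qed.
Lemma rho_adj v u : e v (rho v u) = e v u.
Proof. by rewrite -!rot_mem mem_next. Qed.
Lemma rho'_adj v u : e v (rho' v u) = e v u.
Proof. by rewrite -!rot_mem mem_prev. Qed.

Lemma size_rot v : size (rot v) = deg e v.
Proof.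
by rewrite /deg -(card_uniqP (rot_uniq v)); apply: eq_card => w; rewrite inE rot_mem.
Qed.

Lemma rot_from v u : e v u -> exists s, [/\ uniq (u :: s), size (u :: s) = deg e v,
   forall w, e v w = (w \in u :: s) & rho v =1 next (u :: s)].
Proof.
rewrite -rot_mem => /rot_to[i s defs]; exists s; rewrite -defs.
split; rewrite ?rot_uniq ?size_rot ?seq.rot_uniq ?seq.size_rot ?size_rot //.
- by move=> w; rewrite mem_rot rot_mem.
- by move=> w; rewrite next_rot.
Qed.

Lemma rho_distinct v u : e v u -> 4 <= deg e v ->
  uniq [:: u; rho v u; rho v (rho v u); rho v (rho v (rho v u))].
Proof.
move=> /rot_from[[|a [|b [|c s]]] [us <- _ E]] // _.
have [n1 n2 n3] := next_prefix4 us; rewrite !E n1 n2 n3.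
move: us; rewrite /= !inE !negb_or.
by move=> /and5P[/and4P[-> -> -> _] /and3P[-> -> _] /andP[-> _] _ _].
Qed.

Lemma rho_deg4 v u : e v u -> deg e v = 4 ->
  rho v (rho v (rho v (rho v u))) = u /\
  forall w, e v w = (w \in [:: u; rho v u; rho v (rho v u); rho v (rho v (rho v u))]).
Proof.
move=> /rot_from[[|a [|b [|c [|? ?]]]] [us <- M E]] // _.
have [n1 n2 n3 n4] := next_cycle4 us; rewrite !E n1 n2 n3 n4; split => //.
Qed.

Lemma rho_deg5 v u : e v u -> deg e v = 5 ->
  let u1 := rho v u in let u2 := rho v u1 in let u3 := rho v u2 in
  let u4 := rho v u3 in
  [/\ rho v u4 = u, uniq [:: u; u1; u2; u3; u4]
    & forall w, e v w = (w \in [:: u; u1; u2; u3; u4])].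
Proof.
move=> /rot_from[[|a [|b [|c [|d [|? ?]]]]] [us <- M E]] // _.
by have [n1 n2 n3 n4 n5] := next_cycle5 us; rewrite /= !E n1 n2 n3 n4 n5.
Qed.

End Rotation.

(** * Forbidden adjacencies between faces of length 3, 4 and 5 *)

Section Faces.
Variables (V : finType) (e : rel V) (rot : V -> seq V).
Hypotheses (e_sym : symmetric e) (e_irr : irreflexive e).
Hypotheses (rot_uniq : forall v, uniq (rot v)) (rot_mem : forall v w, (w \in rot v) = e v w).
Hypothesis deg_ge4 : forall v, 4 <= deg e v.
Hypothesis cycle5_triangle : forall a b c d f y,
  uniq [:: a; b; c; d; f] -> e a b -> e b c -> e c d -> e d f -> e f a ->
  e a y -> e b y -> y = c \/ y = f.

Notation r := (rho rot).

(* face3 a b c: the walk (u, v) |-> (v, rho v u) along a face, started at the dart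
   (a, b), closes up as a, b, c; the face across the side ab contains (b, a). *)
Definition face3 a b c := [&& e a b, r b a == c, r c b == a & r a c == b].
Definition face4 a b c d := [&& e a b, r b a == c, r c b == d, r d c == a & r a d == b].
Definition face5 a b c d f :=
  [&& e a b, r b a == c, r c b == d, r d c == f, r f d == a & r a f == b].

Lemma adj_neq a b : e a b -> a != b.
Proof. by apply: contraTneq => ->; rewrite e_irr. Qed.

Ltac distinct := rewrite /= ?inE ?negb_or ?andbT; repeat (apply/andP; split);
  first [ assumption | rewrite eq_sym; assumption
        | apply: adj_neq; first [assumption | rewrite e_sym; assumption] ].

Lemma rho_uniq4 v u : e v u -> uniq [:: u; r v u; r v (r v u); r v (r v (r v u))].
Proof. by move=> evu; apply: (rho_distinct rot_uniq rot_mem). Qed.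

Lemma rho_neq v u : e v u -> r v u != u.
Proof. by move=> /rho_uniq4; rewrite /= !inE !negb_or eq_sym => /andP[/andP[]]. Qed.

Lemma r_adj v u : e v u -> e v (r v u).
Proof. by rewrite (rho_adj rot_mem). Qed.

Lemma face3_rot a b c : face3 a b c -> face3 b c a.
Proof.
rewrite /face3 => /and4P[eab /eqP <- /eqP rc /eqP ra].
by rewrite r_adj ?(e_sym b) // rc ra !eqxx.
Qed.

Lemma face4_rot a b c d : face4 a b c d -> face4 b c d a.
Proof.
rewrite /face4 => /and5P[eab /eqP <- /eqP rc /eqP rd /eqP ra].
by rewrite r_adj ?(e_sym b) // rc rd ra !eqxx.
Qed.

Lemma face3_edges a b c : face3 a b c -> [/\ e a b, e b c & e c a].
Proof.
move=> f; have fb := face3_rot f; have fc := face3_rot fb.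
by split; [case/and4P: f | case/and4P: fb | case/and4P: fc].
Qed.

Lemma face4_edges a b c d : face4 a b c d -> [/\ e a b, e b c, e c d & e d a].
Proof.
move=> f; have fb := face4_rot f; have fc := face4_rot fb; have fd := face4_rot fc.
by split; [case/and5P: f | case/and5P: fb | case/and5P: fc | case/and5P: fd].
Qed.

Lemma face3P a b c : face3 a b c -> [/\ r b a = c, r c b = a & r a c = b].
Proof. by case/and4P=> _ /eqP-> /eqP-> /eqP->. Qed.

Lemma face4P a b c d : face4 a b c d -> [/\ r b a = c, r c b = d, r d c = a & r a d = b].
Proof. by case/and5P=> _ /eqP-> /eqP-> /eqP-> /eqP->. Qed.

Lemma uniq4P (T : eqType) (a b c d : T) : uniq [:: a; b; c; d] ->
  [/\ a != b, a != c, a != d & [/\ b != c, b != d & c != d]].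
Proof.
by rewrite /= !inE !negb_or => /and4P[/and3P[-> -> ->] /andP[-> ->] -> _].
Qed.

(* In a rotation x -> a -> c -> y at v, the four neighbours differ. *)
Lemma rho_distinct4 v x a c y : e v x -> r v x = a -> r v a = c -> r v c = y ->
  [/\ x != a, x != c, x != y & [/\ a != c, a != y & c != y]].
Proof. by move=> evx <- <- <-; apply/uniq4P/rho_uniq4. Qed.

Lemma face4_uniq a b c d : face4 a b c d -> uniq [:: a; b; c; d].
Proof.
move=> f; have [ab bc cd da] := face4_edges f; have [rb rc rd ra] := face4P f.
rewrite /= !inE !negb_or (adj_neq ab) (adj_neq bc) (adj_neq cd) (eq_sym a d) (adj_neq da).
by rewrite -rb -rc eq_sym rho_neq ?[_ == r _ _]eq_sym ?rho_neq // e_sym // rb.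
Qed.

(** The 5-cycle v p q s t shares exactly the edge qs with the triangle v q s, whose other sides are
    chords of the cycle. *)
Lemma no_fan v p q s t : uniq [:: p; q; s; t] -> e v p -> e v q -> e v s -> e v t ->
  e p q -> e q s -> e s t -> False.
Proof.
move=> u vp vq vs vt pq qs st.
have [pq' ps pt [qs' qt st']] := uniq4P u.
have [||||||||E|E] := @cycle5_triangle q s t v p v; rewrite // 1?e_sym //.
- distinct.
- by rewrite E e_irr in vt.
- by rewrite E e_irr in vp.
Qed.

(** The consecutive neighbours x, a, c, y of b would form a path, which [no_fan] excludes. So a
    3-face is adjacent to at most one other. *)
Lemma two_faces3 a b c x y : face3 a b c -> face3 b a x -> face3 c b y -> False.
Proof.
move=> f fx fy; have [ab bc ca] := face3_edges f.
have [ba ax xb] := face3_edges fx; have [cb by_ yc] := face3_edges fy.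
have [rb rc ra] := face3P f; have [qa qx qb] := face3P fx; have [tb ty tc] := face3P fy.
apply: (@no_fan b x a c y); rewrite // 1?e_sym //.
have [xa xc xy [ac ay cy]] := rho_distinct4 (etrans (e_sym _ _) xb) qb rb tb.
distinct.
Qed.

(** Going around the 3-face and the 4-face together gives the 5-cycle c b y z a, of which the
    triangle c b d shares only the edge cb. *)
Lemma diamond_face4l a b c d y z :
  face3 a b c -> face3 c b d -> face4 b a z y -> False.
Proof.
move=> f fd q; have [ab bc ca] := face3_edges f; have [cb bd dc] := face3_edges fd.
have [rb rc ra] := face3P f; have [sb sd sc] := face3P fd.
have [ra' rz ry rb'] := face4P q; have [ba az zy yb] := face4_edges q.
have [ya yc yd [ac ad cd]] := rho_distinct4 (etrans (e_sym _ _) yb) rb' rb sb.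
have [cb' cz _ [bz _ _]] := rho_distinct4 (etrans (e_sym _ _) ca) ra ra' erefl.
have := uniq4P (face4_uniq q) => -[ba' bz' by' [az' ay' zy']].
have [||||||||E|E] := @cycle5_triangle c b y z a d; rewrite // 1?e_sym //.
- distinct.
- by rewrite E eqxx in yd.
- by rewrite E eqxx in ad.
Qed.

Lemma diamond_face4r a b c d y z :
  face3 a b c -> face3 c b d -> face4 a c y z -> False.
Proof.
move=> f fd q; have [ab bc ca] := face3_edges f; have [cb bd dc] := face3_edges fd.
have [rb rc ra] := face3P f; have [sb sd sc] := face3P fd.
have [rc' ry rz ra'] := face4P q; have [ac cy yz za] := face4_edges q.
have [db da dy [ba by_ ay]] := rho_distinct4 (etrans (e_sym _ _) dc) sc rc rc'.
have [zc zb _ _] := rho_distinct4 (etrans (e_sym _ _) za) ra' ra erefl.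
have := uniq4P (face4_uniq q) => -[ac' ay' az' [cy' cz' yz']].
have [||||||||E|E] := @cycle5_triangle b c y z a d; rewrite // 1?e_sym //.
- distinct.
- by rewrite E eqxx in dy.
- by rewrite E eqxx in da.
Qed.

(** Minimum degree 4 makes the vertices of the 5-face distinct and keeps x away from c and f, so the
    5-face and the triangle share only ab. *)
Lemma face5_face3 a b c d f x : face5 b a c d f -> face3 a b x -> False.
Proof.
case/and5P=> ba /eqP ra /eqP rc /eqP rd /andP[/eqP rf /eqP rb] t.
have [ab bx xa] := face3_edges t; have [sb sx sa] := face3P t.
have ac : e a c by rewrite -ra r_adj.
have cd : e c d by rewrite -rc r_adj // e_sym.
have df : e d f by rewrite -rd r_adj // e_sym.
have fb : e f b by rewrite -rf r_adj // e_sym.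
have [xb xc _ _] := rho_distinct4 (etrans (e_sym _ _) xa) sa ra erefl.
have [fa fx _ _] := rho_distinct4 (etrans (e_sym _ _) fb) rb sb erefl.
have bc : c != b by rewrite -ra rho_neq.
have ad : d != a by rewrite -rc rho_neq // e_sym.
have cf : f != c by rewrite -rd rho_neq // e_sym.
have db : b != d by rewrite -rf rho_neq // e_sym.
have [||||||||E|E] := @cycle5_triangle b a c d f x; rewrite // 1?e_sym //.
- distinct.
- by rewrite E eqxx in xc.
- by rewrite E eqxx in fx.
Qed.

(* The 5-cycle a x b c d, applied to triangles through bc, cd and da. *)
Lemma face4_face3 a b c d x : face4 a b c d -> face3 b a x ->
  [/\ x != c, x != d,
      forall y, e b y -> e c y -> y = x \/ y = d,
      forall y, e c y -> e d y -> y = a \/ y = b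
    & forall y, e d y -> e a y -> y = x \/ y = c].
Proof.
move=> q t; have [ab bc cd da] := face4_edges q; have [rb rc rd ra] := face4P q.
have [ba ax xb] := face3_edges t; have [sa sx sb] := face3P t.
have [xa xc _ _] := rho_distinct4 (etrans (e_sym _ _) xb) sb rb erefl.
have [db dx _ _] := rho_distinct4 (etrans (e_sym _ _) da) ra sa erefl.
have := uniq4P (face4_uniq q) => -[ab' ac' ad' [bc' bd' cd']].
have bx := adj_neq (etrans (e_sym _ _) xb).
split=> // [|y by_ cy|y cy dy|y dy ay]; first by rewrite eq_sym.
- have [||||||||E|E] := @cycle5_triangle b c d a x y; rewrite // 1?e_sym //; try by [left|right].
  distinct.
- have [||||||||E|E] := @cycle5_triangle c d a x b y; rewrite // 1?e_sym //; try by [left|right].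
  distinct.
- have [||||||||E|E] := @cycle5_triangle d a x b c y; rewrite // 1?e_sym //; try by [left|right].
  distinct.
Qed.

(** [face4_face3] leaves two candidates for the apex of a second 3-face; each would make two of at
    most four consecutive neighbours of a vertex coincide. *)
Lemma face4_face3_unique a b c d x : face4 a b c d -> face3 b a x ->
  [/\ forall y, ~ face3 c b y, forall y, ~ face3 d c y & forall y, ~ face3 a d y].
Proof.
move=> q t; have [xc xd hbc hcd hda] := face4_face3 q t.
have [ab bc cd da] := face4_edges q; have [rb rc rd ra] := face4P q.
have [ba ax xb] := face3_edges t; have [sa sx sb] := face3P t.
split=> y ty; have [e1 e2 e3] := face3_edges ty; have [t1 t2 t3] := face3P ty.
- have [||E|E] := hbc y; rewrite // 1?e_sym //.
    have [_ _ + _] := rho_distinct4 (etrans (e_sym _ _) xb) sb rb t1.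
    by rewrite E eqxx.
  have [_ + _ _] := rho_distinct4 (etrans (e_sym _ _) e3) t3 rc erefl.
  by rewrite E eqxx.
- have [||E|E] := hcd y; rewrite // 1?e_sym //.
    have [_ + _ _] := rho_distinct4 (etrans (e_sym _ _) e3) t3 rd erefl.
    by rewrite E eqxx.
  have [_ + _ _] := rho_distinct4 (etrans (e_sym _ _) bc) rc t1 erefl.
  by rewrite E eqxx.
- have [||E|E] := hda y; rewrite // 1?e_sym //.
    have [_ _ + _] := rho_distinct4 (etrans (e_sym _ _) e3) t3 ra sa.
    by rewrite E eqxx.
  have [_ + _ _] := rho_distinct4 (etrans (e_sym _ _) cd) rd t1 erefl.
  by rewrite E eqxx.
Qed.

(** The chord ac would make a a common neighbour of b and c, and bd would make b one of d and a;
    [face4_face3] allows neither. *)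
Lemma face4_chordless a b c d x : face4 a b c d -> face3 b a x -> ~~ e a c /\ ~~ e b d.
Proof.
move=> q t; have [xc xd hbc hcd hda] := face4_face3 q t.
have [ab bc cd da] := face4_edges q; have [ba ax xb] := face3_edges t.
have := uniq4P (face4_uniq q) => -[ab' ac' ad' [bc' bd' cd']].
split; apply/negP => ec.
  have [||E|E] := hbc a; rewrite // 1?e_sym //; first by rewrite E e_irr in ax.
  by rewrite E eqxx in ad'.
have [||E|E] := hda b; rewrite // 1?e_sym //; first by rewrite -E e_irr in xb.
by rewrite E eqxx in bc'.
Qed.

End Faces.

(** * Configurations around a 5-vertex *)

Section Configurations.
Variables (V : finType) (e : rel V) (C : finType) (L : V -> {set C}).
Hypotheses (e_sym : symmetric e) (e_irr : irreflexive e) (L4 : forall v, #|L v| = 4).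
Hypotheses (not_col : ~ colorable_on e L setT)
  (crit : forall W : {set V}, W != setT -> colorable_on e L W).

Lemma critical_deg_ge4 v : 4 <= deg e v.
Proof.
rewrite leqNgt; apply/negP => lt4.
apply: (oriented_config_irreducible e_sym L4 not_col crit e_irr (x0 := v)
          (A := [:: v]) (B := [::]) (ab := [::]) (ba := [::])) => //.
by case.
Qed.

Variable rot : V -> seq V.
Hypotheses (rot_uniq : forall v, uniq (rot v)) (rot_mem : forall v w, (w \in rot v) = e v w).
Hypothesis cycle5_triangle : forall a b c d f y,
  uniq [:: a; b; c; d; f] -> e a b -> e b c -> e c d -> e d f -> e f a ->
  e a y -> e b y -> y = c \/ y = f.

Let no_config := oriented_config_irreducible e_sym L4 not_col crit e_irr.
Notation face3 := (face3 e rot).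
Notation face4 := (face4 e rot).
Notation r := (rho rot).
Let f3e := @face3_edges V e rot e_sym rot_mem.
Let f4e := @face4_edges V e rot e_sym rot_mem.
Let f3P := @face3P V e rot.
Let f4P := @face4P V e rot.
Let f3r := @face3_rot V e rot e_sym rot_mem.
Let f4r := @face4_rot V e rot e_sym rot_mem.
Let f4u := @face4_uniq V e rot e_sym e_irr rot_uniq rot_mem critical_deg_ge4.
Let rho_distinct4 := @rho_distinct4 V e rot rot_uniq rot_mem critical_deg_ge4.
Let f4f3 := @face4_face3 V e rot e_sym e_irr rot_uniq rot_mem critical_deg_ge4 cycle5_triangle.
Let f4cl := @face4_chordless V e rot e_sym e_irr rot_uniq rot_mem critical_deg_ge4 cycle5_triangle.
Let fan := @no_fan V e e_sym e_irr cycle5_triangle.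
Let adj_neq := @adj_neq V e e_irr.

Ltac distinct := rewrite /= ?inE ?negb_or ?andbT; repeat (apply/andP; split);
  first [ assumption | rewrite eq_sym; assumption
        | apply: adj_neq; first [assumption | rewrite e_sym; assumption] ].

(** Orienting the chordless square cyclically gives each vertex in-degree 1 = 4 - 3. *)
Lemma low_square a b c d x : face4 a b c d -> face3 b a x ->
  deg e a = 4 -> deg e b = 4 -> deg e c = 4 -> deg e d = 4 -> False.
Proof.
move=> q t da db dc dd; have [nac nbd] := f4cl q t.
have [ab bc cd da'] := f4e q.
have := uniq4P (f4u q) => -[ab' ac' ad' [bc' bd' cd']].
apply: (no_config (x0 := a) (A := [:: a; c]) (B := [:: b; d])
   (ab := [:: (0, 0); (1, 1)]) (ba := [:: (1, 0); (0, 1)])) => //.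
- distinct.
- by rewrite /= nac.
- by rewrite /= nbd.
- by apply/allP; rewrite /= ab cd e_sym bc e_sym da'.
- by case=> [|[|]] //= _; rewrite ?da ?dc.
- by case=> [|[|]] //= _; rewrite ?db ?dd.
Qed.

(* Let b1, b2, b3 be consecutive neighbours of c and let a1, a2 be the vertices
   opposite to c on the 4-faces between them. A 3-face lies across a side of the
   first (second) of these 4-faces other than the common side c b2. *)
Definition left_tri a1 b2 b1 c :=
  [\/ exists x, face3 a1 b2 x, exists x, face3 b1 a1 x | exists x, face3 c b1 x].
Definition right_tri a2 b2 b3 c :=
  [\/ exists x, face3 b2 a2 x, exists x, face3 a2 b3 x | exists x, face3 b3 c x].

Lemma left_chordless c b2 a1 b1 : face4 c b2 a1 b1 -> left_tri a1 b2 b1 c ->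
  ~~ e c a1 /\ ~~ e b2 b1.
Proof.
move=> q [] [x t]; have q1 := f4r q; have q2 := f4r q1; have q3 := f4r q2.
- by have [? ?] := f4cl q1 t; split; rewrite // e_sym.
- by have [? ?] := f4cl q2 t; split; rewrite // e_sym.
- by have [? ?] := f4cl q3 t; split; rewrite // e_sym.
Qed.

Lemma right_chordless c b3 a2 b2 : face4 c b3 a2 b2 -> right_tri a2 b2 b3 c ->
  ~~ e c a2 /\ ~~ e b3 b2.
Proof.
move=> q [] [x t]; have q1 := f4r q; have q2 := f4r q1; have q3 := f4r q2.
- by have [? ?] := f4cl q2 t; split; rewrite // e_sym.
- by have [? ?] := f4cl q1 t; split; rewrite // e_sym.
- by have [? ?] := f4cl q t; split; rewrite // e_sym.
Qed.

(** An edge b1 b3 would close a triangle with c, an edge a1 a2 one with b2. [face4_face3], applied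
    to both 4-faces, leaves only cases where an end of that edge is the apex of a neighbouring
    3-face or where 3-faces meet at c or b2; these end in a fan, a pair of adjacent 3-faces beside a
    4-face, or a coincidence in a rotation. *)
Lemma domino_separated c b1 b2 b3 a1 a2 :
    face4 c b2 a1 b1 -> face4 c b3 a2 b2 ->
    left_tri a1 b2 b1 c -> right_tri a2 b2 b3 c ->
    deg e c = 5 -> deg e b2 = 4 ->
  [/\ ~~ e b1 b3, ~~ e a1 a2 & uniq ([:: c; a1; a2] ++ [:: b1; b2; b3])].
Proof.
move=> q1 q2 t1 t2 dc db2.
have [cb2 b2a1 a1b1 b1c] := f4e q1; have [cb3 b3a2 a2b2 b2c] := f4e q2.
have [rb2c ra1 rb1 rcb1] := f4P q1; have [rb3 ra2 rb2a2 rcb2] := f4P q2.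
have [nca1 nb21] := left_chordless q1 t1; have [nca2 nb32] := right_chordless q2 t2.
have := uniq4P (f4u q1) => -[cb2' ca1' cb1' [b2a1' b2b1' a1b1']].
have := uniq4P (f4u q2) => -[cb3' ca2' cb2'' [b3a2' b3b2' a2b2']].
have eb1c := etrans (e_sym _ _) b1c.
have [b12' b13' b14' [b23' b24' b34']] := rho_distinct4 eb1c rcb1 rcb2 erefl.
have eb2a2 := etrans (e_sym _ _) a2b2.
have [a2c' a2a1' _ [ca1'' _ _]] := rho_distinct4 eb2a2 rb2a2 rb2c erefl.
have a1b3 : a1 != b3 by apply: contraNneq nb32 => <-; rewrite e_sym.
have a2b1 : a2 != b1 by apply: contraNneq nb21 => <-; rewrite e_sym.
have q1a := f4r q1; have q1b := f4r q1a; have q1c := f4r q1b.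
have q2a := f4r q2; have q2b := f4r q2a; have q2c := f4r q2b.
split; last by distinct.
- apply/negP => e13.
  case: t1 => -[x1 t1]; have [t1a t1b t1c] := f3e t1; have [s1a s1b s1c] := f3P t1.
  + have [_ _ _ h _] := f4f3 q1a t1.
    by have [||E|E] := h b3; rewrite // 1?e_sym //; move: a1b3 b3b2'; rewrite E eqxx.
  + have [_ _ h _ _] := f4f3 q1b t1.
    have [||E|E] := h b3; rewrite // 1?e_sym //; last by move: b3b2'; rewrite E eqxx.
    destruct E; case: t2 => -[x2 t2]; have [t2a t2b t2c] := f3e t2; have [s2a s2b s2c] := f3P t2.
    * have [_ _ _ h2 _] := f4f3 q2b t2.
      have [||E|E] := h2 b1; rewrite // 1?e_sym //; first by move: a2b1; rewrite E eqxx.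
      by move: b2b1'; rewrite E eqxx.
    * have [_ _ _ _ h2] := f4f3 q2a t2.
      have [||E|E] := h2 b1; rewrite // 1?e_sym //; last by move: b2b1'; rewrite E eqxx.
      by destruct E; move: a2a1'; rewrite -s2b s1c eqxx.
    * have [y1 y2 _ _ _] := f4f3 q2 t2.
      (* Around c, of degree 5, the vertices b1, b2, b3, x2 are consecutive, hence distinct. *)
      have x2b1 : x2 != b1.
        have [_ u _] := rho_deg5 rot_uniq rot_mem eb1c dc.
        move: u; rewrite /= rcb1 rcb2 s2a !inE !negb_or => /andP[/and4P[_ _ b1x2 _] _].
        by rewrite eq_sym.
      have x2a1 : x2 != a1 by apply: contraNneq nca1 => <-.
      apply: (@fan b3 x2 c b1 a1); rewrite // 1?e_sym //.
      distinct.
  + case: t2 => -[x2 t2]; have [t2a t2b t2c] := f3e t2; have [s2a s2b s2c] := f3P t2.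
    * have [_ _ _ h2 _] := f4f3 q2b t2.
      have [||E|E] := h2 b1; rewrite // 1?e_sym //; first by move: a2b1; rewrite E eqxx.
      by move: b2b1'; rewrite E eqxx.
    * have [_ _ _ _ h2] := f4f3 q2a t2.
      have [||E|E] := h2 b1; rewrite // 1?e_sym //; last by move: b2b1'; rewrite E eqxx.
      destruct E.
      have x1b3 : x1 != b3.
        have ex1 : e c x1 by rewrite e_sym.
        have := rho_deg5 rot_uniq rot_mem ex1 dc; rewrite /= s1c rcb1 rcb2.
        by case=> _; rewrite !inE !negb_or => /andP[/and4P[]].
      have x1a2 : x1 != a2 by apply: contraNneq nca2 => <-; rewrite e_sym.
      apply: (@fan b1 x1 c b3 a2); rewrite // 1?e_sym //.
      distinct.
    * have ex1 : e c x1 by rewrite e_sym.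
      have := rho_deg5 rot_uniq rot_mem ex1 dc; rewrite /= s1c rcb1 rcb2 s2a.
      case=> _; rewrite !inE !negb_or => /andP[/and4P[x1b1 x1b2 x1b3 x1x2]].
      move=> /and3P[/and3P[_ _ b1x2] /andP[_ _] /andP[b3x2 _]] _.
      apply: (@fan c x1 b1 b3 x2); rewrite // 1?e_sym //.
      distinct.
- apply/negP => e12.
  case: t1 => -[x1 t1]; have [t1a t1b t1c] := f3e t1; have [s1a s1b s1c] := f3P t1.
  + have [z1 z2 z3 [z4 z5 z6]] := rho_distinct4 eb2a2 rb2a2 rb2c s1a.
    case: t2 => -[x2 t2]; have [t2a t2b t2c] := f3e t2; have [s2a s2b s2c] := f3P t2.
    (* As b2 has degree 4, its neighbours in order are a2, c, a1, x1, so the two apexes coincide and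
       the 3-faces at b2 are adjacent, with a 4-face beside them. *)
    * have [E _] := rho_deg4 rot_uniq rot_mem eb2a2 db2.
      move: E; rewrite rb2a2 rb2c s1a -{1}s2c => /(can_inj (rhoK rot_uniq _)) E; destruct E.
      apply: (@diamond_face4l V e rot e_sym e_irr rot_uniq rot_mem critical_deg_ge4
        cycle5_triangle a1 b2 x1 a2 c b1) => //.
      by apply: f3r; apply: f3r.
    * have [_ _ h2 _ _] := f4f3 q2a t2.
      have [||E|E] := h2 a1; rewrite // 1?e_sym //; last by move: ca1'; rewrite E eqxx.
      destruct E.
      have x1b3 : x1 != b3 by apply: contraNneq nb32 => <-; rewrite e_sym.
      apply: (@fan a1 x1 b2 a2 b3); rewrite // 1?e_sym //.
      distinct.
    * have [_ _ _ h2 _] := f4f3 q2 t2.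
      have [||E|E] := h2 a1; rewrite // 1?e_sym //; first by move: ca1'; rewrite E eqxx.
      by move: a1b3; rewrite E eqxx.
  + have [_ _ _ _ h1] := f4f3 q1b t1.
    have [||E|E] := h1 a2; rewrite // 1?e_sym //; last by move: ca2'; rewrite E eqxx.
    destruct E.
    case: t2 => -[x2 t2]; have [t2a t2b t2c] := f3e t2; have [s2a s2b s2c] := f3P t2.
    * have [z1 z2 z3 [z4 z5 z6]] := rho_distinct4 (etrans (e_sym _ _) t2c) s2c rb2a2 rb2c.
      have x2b1 : x2 != b1 by apply: contraNneq nb21 => <-; rewrite e_sym.
      apply: (@fan a2 x2 b2 a1 b1); rewrite // 1?e_sym //.
      distinct.
    * have [_ _ h2 _ _] := f4f3 q2a t2.
      have [||E|E] := h2 a1; rewrite // 1?e_sym //; last by move: ca1'; rewrite E eqxx.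
      by destruct E; move: b13'; rewrite -s1b -s2c eqxx.
    * have [_ _ _ h2 _] := f4f3 q2 t2.
      have [||E|E] := h2 a1; rewrite // 1?e_sym //; first by move: ca1'; rewrite E eqxx.
      by move: a1b3; rewrite E eqxx.
  + have [_ _ _ h1 _] := f4f3 q1c t1.
    have [||E|E] := h1 a2; rewrite // 1?e_sym //; first by move: a2b1; rewrite E eqxx.
    by move: ca2'; rewrite E eqxx.
Qed.

(** The seven edges can be oriented with in-degree 2 = 5 - 3 at c and 1 at each of the other five
    vertices. *)
Lemma domino_irreducible c b1 b2 b3 a1 a2 :
    face4 c b2 a1 b1 -> face4 c b3 a2 b2 ->
    left_tri a1 b2 b1 c -> right_tri a2 b2 b3 c ->
    deg e c = 5 -> deg e b1 = 4 -> deg e b2 = 4 -> deg e b3 = 4 ->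
    deg e a1 = 4 -> deg e a2 = 4 ->
  False.
Proof.
move=> q1 q2 t1 t2 dc db1 db2 db3 da1 da2.
have [nb13 na12 u] := domino_separated q1 q2 t1 t2 dc db2.
have [cb2 b2a1 a1b1 b1c] := f4e q1; have [cb3 b3a2 a2b2 b2c] := f4e q2.
have [nca1 nb21] := left_chordless q1 t1; have [nca2 nb32] := right_chordless q2 t2.
apply: (no_config (x0 := c) (A := [:: c; a1; a2]) (B := [:: b1; b2; b3])
   (ab := [:: (0, 1); (1, 0); (2, 2)]) (ba := [:: (0, 0); (0, 2); (1, 1); (2, 1)])) => //.
- by rewrite /= nca1 nca2 na12.
- by rewrite /= e_sym nb21 nb13 e_sym nb32.
- by apply/allP; rewrite /= cb2 a1b1 e_sym b3a2 e_sym b1c cb3 e_sym b2a1 a2b2.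
- by case=> [|[|[|]]] //= _; rewrite ?dc ?da1 ?da2.
- by case=> [|[|[|]]] //= _; rewrite ?db1 ?db2 ?db3.
Qed.

(** The edge b1 b4 is excluded as in [domino_separated]. An edge a1 a3 would give the 5-cycle b2 a2
    b3 a3 a1, which shares one edge with the 3-face across b2 a2 or a2 b3. *)
Lemma triple_separated c b1 b2 b3 b4 a1 a2 a3 :
    face4 c b2 a1 b1 -> face4 c b3 a2 b2 -> face4 c b4 a3 b3 ->
    left_tri a1 b2 b1 c -> right_tri a3 b3 b4 c ->
    (exists x, face3 b2 a2 x) \/ (exists x, face3 a2 b3 x) ->
    deg e c = 5 -> deg e b2 = 4 -> deg e b3 = 4 -> a1 != a3 ->
  ~~ e b1 b4 /\ ~~ e a1 a3.
Proof.
move=> q1 q2 q3 t1 t3 t2 dc db2 db3 a13.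
have t2r : right_tri a2 b2 b3 c by case: t2 => t; [constructor 1|constructor 2].
have t2l : left_tri a2 b3 b2 c by case: t2 => t; [constructor 2|constructor 1].
have [nb13 na12 u1] := domino_separated q1 q2 t1 t2r dc db2.
have [nb24 na23 u2] := domino_separated q2 q3 t2l t3 dc db3.
have [cb2 b2a1 a1b1 b1c] := f4e q1; have [cb3 b3a2 a2b2 b2c] := f4e q2.
have [cb4 b4a3 a3b3 b3c] := f4e q3.
have [rb2c ra1 rb1 rcb1] := f4P q1; have [rb3c ra2 rb2a2 rcb2] := f4P q2.
have [rb4c ra3 rb3a3 rcb3] := f4P q3.
have [nca1 nb21] := left_chordless q1 t1; have [nca3 nb43] := right_chordless q3 t3.
have [nca2 nb32] := right_chordless q2 t2r.
have q1a := f4r q1; have q1b := f4r q1a; have q1c := f4r q1b.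
have q3a := f4r q3; have q3b := f4r q3a; have q3c := f4r q3b.
have eb1c := etrans (e_sym _ _) b1c.
have [rb5 u _] := rho_deg5 rot_uniq rot_mem eb1c dc.
move: rb5 u; rewrite rcb1 rcb2 rcb3 => rb5.
rewrite /= !inE !negb_or => /and5P[/and4P[b12 b13 b14 b15] /and3P[b23 b24 b25]].
move=> /andP[b34 b35] b45 _.
have := uniq4P (f4u q1) => -[cb2' ca1' cb1' [b2a1' b2b1' a1b1']].
have := uniq4P (f4u q3) => -[cb4' ca3' cb3' [b4a3' b4b3' a3b3']].
have a1b4 : a1 != b4 by apply: contraNneq nb24 => <-.
have a3b1 : a3 != b1 by apply: contraNneq nb13 => <-.
have a1b3 : a1 != b3 by apply: contraNneq nb32 => <-; rewrite e_sym.
have a3b2 : a3 != b2 by apply: contraNneq nb32 => <-; rewrite e_sym.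
split; apply/negP => ed.
- case: t1 => -[x1 t1]; have [t1a t1b t1c] := f3e t1; have [s1a s1b s1c] := f3P t1.
  + have [_ _ _ h _] := f4f3 q1a t1.
    have [||E|E] := h b4; rewrite // 1?e_sym //; first by move: b24; rewrite E eqxx.
    by move: a1b4; rewrite E eqxx.
  + have [_ _ h _ _] := f4f3 q1b t1.
    have [||E|E] := h b4; rewrite // 1?e_sym //; last by move: b24; rewrite E eqxx.
    destruct E; case: t3 => -[x3 t3]; have [t3a t3b t3c] := f3e t3; have [s3a s3b s3c] := f3P t3.
    * have [_ _ _ h3 _] := f4f3 q3b t3.
      have [||E|E] := h3 b1; rewrite // 1?e_sym //; first by move: a3b1; rewrite E eqxx.
      by move: b13; rewrite E eqxx.
    * have [_ _ _ _ h3] := f4f3 q3a t3.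
      have [||E|E] := h3 b1; rewrite // 1?e_sym //; last by move: b13; rewrite E eqxx.
      by destruct E; move: a13; rewrite -s3b s1c eqxx.
    * have x3b1 : x3 != b1 by rewrite -s3a eq_sym.
      have x3a1 : x3 != a1 by apply: contraNneq nca1 => <-.
      apply: (@fan b4 x3 c b1 a1); rewrite // 1?e_sym //.
      distinct.
  + case: t3 => -[x3 t3]; have [t3a t3b t3c] := f3e t3; have [s3a s3b s3c] := f3P t3.
    * have [_ _ _ h3 _] := f4f3 q3b t3.
      have [||E|E] := h3 b1; rewrite // 1?e_sym //; first by move: a3b1; rewrite E eqxx.
      by move: b13; rewrite E eqxx.
    * have [_ _ _ _ h3] := f4f3 q3a t3.
      have [||E|E] := h3 b1; rewrite // 1?e_sym //; last by move: b13; rewrite E eqxx.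
      destruct E.
      have x1b4 : x1 != b4.
        apply: contraNneq b45 => E; rewrite -rb5 in s1c.
        by move: s1c => /(can_inj (rhoK rot_uniq _)) <-; rewrite E.
      have x1a3 : x1 != a3 by apply: contraNneq nca3 => <-; rewrite e_sym.
      apply: (@fan b1 x1 c b4 a3); rewrite // 1?e_sym //.
      distinct.
    (* Both apexes are the fifth neighbour of c, so the two 3-faces at c are adjacent and have a
       4-face beside them. *)
    * have E : x3 = x1.
        by rewrite -s3a; apply: (can_inj (rhoK rot_uniq c)); rewrite rb5 s1c.
      destruct E.
      apply: (@diamond_face4r V e rot e_sym e_irr rot_uniq rot_mem critical_deg_ge4
        cycle5_triangle b1 x3 c b4 b2 a1).
      - by apply: f3r.
      - by apply: f3r.
      - by apply: f4r; apply: f4r; apply: f4r.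
- have a2b2' := adj_neq a2b2; have b2c' := adj_neq b2c; have b3c' := adj_neq b3c.
  case: t2 => -[x2 t2]; have [t2a t2b t2c] := f3e t2; have [s2a s2b s2c] := f3P t2.
  + have eb2x2 := etrans (e_sym _ _) t2c.
    have [z1 z2 z3 [z4 z5 z6]] := rho_distinct4 eb2x2 s2c rb2a2 rb2c.
    have a23 : a2 != a3.
      by move: u2; rewrite /= !inE !negb_or => /and5P[_ /andP[]].
    have [||||||||E|E] := @cycle5_triangle b2 a2 b3 a3 a1 x2; rewrite // 1?e_sym //.
    * distinct.
    * by move: nb32; rewrite -E e_sym eb2x2.
    * by move: z3; rewrite E eqxx.
  + have eb3a3 := etrans (e_sym _ _) a3b3.
    have [z1 z2 z3 [z4 z5 z6]] := rho_distinct4 eb3a3 rb3a3 rb3c s2a.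
    have a12 : a1 != a2.
      by move: u1; rewrite /= !inE !negb_or => /and5P[_ /andP[]].
    have [||||||||E|E] := @cycle5_triangle a2 b3 a3 a1 b2 x2; rewrite // 1?e_sym //.
    * distinct.
    * by move: z3; rewrite E eqxx.
    * by move: nb32; rewrite -E t2b.
Qed.

Lemma triple_irreducible c b1 b2 b3 b4 a1 a2 a3 :
    face4 c b2 a1 b1 -> face4 c b3 a2 b2 -> face4 c b4 a3 b3 ->
    left_tri a1 b2 b1 c -> right_tri a3 b3 b4 c ->
    (exists x, face3 b2 a2 x) \/ (exists x, face3 a2 b3 x) ->
    deg e c = 5 -> deg e a2 = 5 -> deg e b1 = 4 -> deg e b2 = 4 -> deg e b3 = 4 ->
    deg e b4 = 4 -> deg e a1 = 4 -> deg e a3 = 4 ->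
  False.
Proof.
move=> q1 q2 q3 t1 t3 t2 dc da2 db1 db2 db3 db4 da1 da3.
have t2r : right_tri a2 b2 b3 c by case: t2 => t; [constructor 1|constructor 2].
have t2l : left_tri a2 b3 b2 c by case: t2 => t; [constructor 2|constructor 1].
have [nb13 na12 u1] := domino_separated q1 q2 t1 t2r dc db2.
have [nb24 na23 u2] := domino_separated q2 q3 t2l t3 dc db3.
have [cb2 b2a1 a1b1 b1c] := f4e q1; have [cb3 b3a2 a2b2 b2c] := f4e q2.
have [cb4 b4a3 a3b3 b3c] := f4e q3.
have [nca1 nb21] := left_chordless q1 t1; have [nca3 nb43] := right_chordless q3 t3.
have [nca2 nb32] := right_chordless q2 t2r.
(* If a1 = a3, the vertex b1 is left out. In both cases the orientation has in-degree 2 at c and a2,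
   and 1 at every other vertex. *)
have [E|a13] := eqVneq a1 a3.
  destruct E.
  apply: (no_config (x0 := c) (A := [:: c; a1; a2]) (B := [:: b2; b3; b4])
     (ab := [:: (0, 0); (1, 1); (1, 2)])
     (ba := [:: (0, 1); (0, 2); (1, 0); (2, 0); (2, 1)])) => //.
  - move: u1 u2; rewrite /= !inE !negb_or.
    move=> /and5P[/and5P[ca1 ca2 cb1' cb2' cb3'] /and4P[a12 ab1 ab2 ab3]].
    move=> /and3P[a2b1 a2b2' a2b3] /andP[b12 b13] /andP[b23 _].
    move=> /and5P[/and5P[_ _ _ _ cb4'] /and4P[_ _ _ a2b4]].
    move=> /and3P[_ _ ab4] /andP[_ b24] /andP[b34 _].
    distinct.
  - by rewrite /= nca1 nca2 na12.
  - by rewrite /= e_sym nb32 nb24 e_sym nb43.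
  - by apply/allP; rewrite /= cb2 a3b3 e_sym b4a3 cb3 cb4 e_sym b2a1 a2b2 e_sym b3a2.
  - by case=> [|[|[|]]] //= _; rewrite ?dc ?da1 ?da2.
  - by case=> [|[|[|]]] //= _; rewrite ?db2 ?db3 ?db4.
have [nb14 na13] := triple_separated q1 q2 q3 t1 t3 t2 dc db2 db3 a13.
apply: (no_config (x0 := c) (A := [:: c; a1; a2; a3]) (B := [:: b1; b2; b3; b4])
   (ab := [:: (0, 1); (0, 2); (1, 0); (3, 3)])
   (ba := [:: (0, 0); (0, 3); (2, 1); (2, 2); (1, 1); (3, 2)])) => //.
- have [rb2c ra1 rb1 rcb1] := f4P q1; have [rb3c ra2 rb2a2 rcb2] := f4P q2.
  have [rb4c ra3 rb3a3 rcb3] := f4P q3.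
  have [_ _ b14 _] := rho_distinct4 (etrans (e_sym _ _) b1c) rcb1 rcb2 rcb3.
  have a1b4 : a1 != b4 by apply: contraNneq nb24 => <-.
  have a3b1 : a3 != b1 by apply: contraNneq nb13 => <-.
  have a3b2 : a3 != b2 by apply: contraNneq nb32 => <-; rewrite e_sym.
  move: u1 u2; rewrite /= !inE !negb_or.
  move=> /and5P[/and5P[ca1 ca2 cb1' cb2' cb3'] /and4P[a12 ab1 ab2 ab3]].
  move=> /and3P[a2b1 a2b2' a2b3] /andP[b12 b13] /andP[b23 _].
  move=> /and5P[/and5P[_ ca3 _ _ cb4'] /and4P[a23 _ _ a2b4]].
  move=> /and3P[_ a3b3' ab4] /andP[_ b24] /andP[b34 _].
  distinct.
- by rewrite /= nca1 nca2 nca3 na12 na13 na23.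
- by rewrite /= e_sym nb21 nb13 nb14 e_sym nb32 nb24 e_sym nb43.
- apply/allP; rewrite /= cb2 cb3 a1b1 cb4 (e_sym a3) b4a3 (e_sym c) b1c a2b2 (e_sym a2) b3a2.
  by rewrite (e_sym a1) b2a1 a3b3.
- by case=> [|[|[|[|]]]] //= _; rewrite ?dc ?da1 ?da2 ?da3.
- by case=> [|[|[|[|]]]] //= _; rewrite ?db1 ?db2 ?db3 ?db4.
Qed.

End Configurations.

(** * Discharging *)

Section Discharging.
Variables (V : finType) (e : rel V) (C : finType) (L : V -> {set C}).
Hypotheses (e_sym : symmetric e) (e_irr : irreflexive e) (L4 : forall v, #|L v| = 4).
Hypotheses (not_col : ~ colorable_on e L setT)
  (crit : forall W : {set V}, W != setT -> colorable_on e L W).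
Variable rot : V -> seq V.
Hypotheses (rot_uniq : forall v, uniq (rot v)) (rot_mem : forall v w, (w \in rot v) = e v w).
Hypothesis cycle5_triangle : forall a b c d f y,
  uniq [:: a; b; c; d; f] -> e a b -> e b c -> e c d -> e d f -> e f a ->
  e a y -> e b y -> y = c \/ y = f.

Let deg_ge4 := critical_deg_ge4 e_sym e_irr L4 not_col crit.
Notation face3 := (face3 e rot).
Notation face4 := (face4 e rot).
Notation face5 := (face5 e rot).
Notation r := (rho rot).
Notation r' := (rho' rot).
Notation deg := (deg e).
Let rK v : cancel (r v) (r' v) := rhoK rot_uniq v.
Let r'K v : cancel (r' v) (r v) := rho'K rot_uniq v.
Let r_adj v u : e v (r v u) = e v u := rho_adj rot_mem v u.
Let r'_adj v u : e v (r' v u) = e v u := rho'_adj rot_mem v u.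
Let f3e := @face3_edges V e rot e_sym rot_mem.
Let f4e := @face4_edges V e rot e_sym rot_mem.
Let f3P := @face3P V e rot.
Let f4P := @face4P V e rot.
Let f3r := @face3_rot V e rot e_sym rot_mem.
Let f4r := @face4_rot V e rot e_sym rot_mem.
Let f4u := @face4_uniq V e rot e_sym e_irr rot_uniq rot_mem deg_ge4.

Definition tri u v := face3 u v (r v u).
Definition quad u v := face4 u v (r v u) (r (r v u) v).
Definition pent u v := let w := r v u in let x := r w v in face5 u v w x (r x w).
(** A simple graph of minimum degree 4 has no face of length 1 or 2, so these are the darts of the
    faces of length at least 6. *)
Definition large u v := [&& e u v, ~~ tri u v, ~~ quad u v & ~~ pent u v].

Lemma tri_e u v : tri u v -> e u v. Proof. by case/and4P. Qed.
Lemma face3_tri a b c : face3 a b c -> tri a b.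
Proof. by rewrite /tri => f; have [-> _ _] := f3P f. Qed.
Lemma face4_quad a b c d : face4 a b c d -> quad a b.
Proof. by rewrite /quad => f; have [-> -> _ _] := f4P f. Qed.

Lemma tri_step u v : tri v (r v u) = tri u v.
Proof.
apply/idP/idP => f; last by have := f3r f; apply: face3_tri.
have := f3r (f3r f); have [_ _] := f3P f => /(can_inj (rK v)) ->.
exact: face3_tri.
Qed.

Lemma quad_step u v : quad v (r v u) = quad u v.
Proof.
apply/idP/idP => f; last by have := f4r f; apply: face4_quad.
have := f4r (f4r (f4r f)); have [_ _ _] := f4P f => /(can_inj (rK v)) ->.
exact: face4_quad.
Qed.

Lemma pent_step u v : pent v (r v u) = pent u v.
Proof.
rewrite /pent /face5 !eqxx /= r_adj (e_sym v u).
set w := r v u; set x := r w v; set y := r x w.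
apply/andP/andP => -[euv].
  move=> /andP[/eqP h1 /eqP/(can_inj (rK v)) h2]; move: h1; rewrite h2 => ->.
  by rewrite !eqxx.
by move=> /andP[/eqP-> /eqP->]; rewrite !eqxx.
Qed.

Lemma large_step u v : large v (r v u) = large u v.
Proof. by rewrite /large tri_step quad_step pent_step r_adj e_sym. Qed.

Lemma tri_quadF u v : tri u v -> quad u v -> False.
Proof.
move=> t q; have [_ E _] := f3P t; have := f4u q; rewrite E.
by rewrite /= !inE eqxx !orbT.
Qed.

Lemma tri_pent u v : tri u v -> pent v u -> False.
Proof.
by move=> t p; apply: (face5_face3 e_sym e_irr rot_uniq rot_mem deg_ge4 cycle5_triangle p t).
Qed.

Lemma tri_sides a b c : face3 a b c -> tri c b -> ~~ tri b a /\ ~~ tri a c.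
Proof.
move=> f t; have [ab bc ca] := f3e f; split; apply/negP => t2.
- exact: (two_faces3 e_sym e_irr rot_uniq rot_mem deg_ge4 cycle5_triangle f t2 t).
- have f' := f3r f.
  exact: (two_faces3 e_sym e_irr rot_uniq rot_mem deg_ge4 cycle5_triangle f' t t2).
Qed.

Lemma diamond_large a b c : face3 a b c -> tri c b -> large b a /\ large a c.
Proof.
move=> f t; have [ab bc ca] := f3e f; have [n1 n2] := tri_sides f t.
rewrite /large n1 n2 (e_sym b) ab (e_sym a) ca /=.
split; apply/andP; split; apply/negP => q.
- exact: (diamond_face4l e_sym e_irr rot_uniq rot_mem deg_ge4 cycle5_triangle f t q).
- by apply: (tri_pent (face3_tri f) q).
- exact: (diamond_face4r e_sym e_irr rot_uniq rot_mem deg_ge4 cycle5_triangle f t q).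
- by apply: (tri_pent (face3_tri (f3r (f3r f))) q).
Qed.

(* A degree 4 end of the common edge of two triangles bounds an edge with large
   faces on both sides. *)
Lemma diamond_low_tail b c : tri b c -> tri c b -> deg b = 4 ->
  let m := r' b (r' b c) in large m b /\ ~~ tri b m.
Proof.
move=> t t' db m; set a := r c b.
have [_ _ rba] : [/\ r c b = a, r a c = b & r b a = c] := f3P t.
have aE : r' b c = a by rewrite -rba rK.
have rm : r b m = a by rewrite /m aE r'K.
have f : face3 a b c by apply: f3r; apply: f3r.
have [l1 l2] := diamond_large f t'.
split; first by rewrite -large_step rm.
have [E _] := rho_deg4 rot_uniq rot_mem (tri_e t) db.
have rbc2 : r b (r b c) = m by apply: (can_inj (rK b)); apply: (can_inj (rK b)); rewrite E rm.
rewrite -rbc2 -[X in tri b X]/(r b (r b c)) tri_step.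
by have [] := tri_sides (f3r (f3r t')) t.
Qed.

Lemma diamond_low_head b c : tri b c -> tri c b -> deg c = 4 ->
  let m := r c (r c b) in large c m /\ ~~ tri m c.
Proof.
move=> t t' dc m; set a := r c b.
have [_ rac rba] : [/\ r c b = a, r a c = b & r b a = c] := f3P t.
have f : face3 a b c by apply: f3r; apply: f3r.
have [l1 l2] := diamond_large f t'.
split; first by rewrite large_step.
have [E _] := rho_deg4 rot_uniq rot_mem (tri_e t') dc.
have [_ _ rcd] := f3P t'.
have rcm : r c m = r b c by apply: (can_inj (rK c)); rewrite rcd.
by rewrite -tri_step rcm; have [] := tri_sides (f3r (f3r t')) t.
Qed.

Definition beside_tri u v := let w := r v u in let x := r w v in
  [|| tri v u, tri w v, tri x w | tri u x].

Definition face_count (p : nat -> bool) u v : nat := let w := r v u in let x := r w v in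
  p (deg u) + p (deg v) + p (deg w) + p (deg x).

(* What a vertex of degree d pays to a 4-face beside a 3-face, when n5 (n6) vertices
   of the 4-face have degree at least 5 (6). *)
Definition share (d n5 n6 : nat) : nat :=
  if 6 <= d then 2 else if d < 5 then 0 else if 0 < n6 then 0 else
  if n5 == 1 then 2 else 1.

Definition quad_share u v := if quad u v && beside_tri u v
  then share (deg u) (face_count (leq 5) u v) (face_count (leq 6) u v) else 0.

(* The sides at u of the face of (u, v) are uv and u (rho' u v). *)
Definition diamond_share u v : nat :=
  if tri u v && (5 <= deg u) then tri v u + tri u (r' u v) else 0.

Lemma face4_beside a b c d : face4 a b c d ->
  beside_tri a b = [|| tri b a, tri c b, tri d c | tri a d].
Proof. by move=> /f4P[E1 E2 _ _]; rewrite /beside_tri E1 E2. Qed.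

Lemma face4_count p a b c d : face4 a b c d ->
  face_count p a b = p (deg a) + p (deg b) + p (deg c) + p (deg d).
Proof. by move=> /f4P[E1 E2 _ _]; rewrite /face_count E1 E2. Qed.

Lemma face4_count_step p a b c d : face4 a b c d -> face_count p b c = face_count p a b.
Proof. by move=> q; rewrite (face4_count p q) (face4_count p (f4r q)) addnC !addnA. Qed.

(** One vertex of degree at least 6 gives 2 by itself. Without one, a single 5-vertex gives 2 and
    several give 1 each. *)
Lemma share_sum (a b c d : nat) :
  let n5 := (5 <= a) + (5 <= b) + (5 <= c) + (5 <= d) in
  let n6 := (6 <= a) + (6 <= b) + (6 <= c) + (6 <= d) in
  0 < n5 -> 2 <= share a n5 n6 + share b n5 n6 + share c n5 n6 + share d n5 n6.
Proof.
have E x : (x < 5) = ~~ (5 <= x) by rewrite -ltnNge.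
have I x : (6 <= x) ==> (5 <= x) by apply/implyP; apply: ltnW.
rewrite /share !E; have := (I a, I b, I c, I d); do 4!case=> [].
case: (5 <= a); case: (6 <= a) => //= _;
case: (5 <= b); case: (6 <= b) => //= _;
case: (5 <= c); case: (6 <= c) => //= _;
by case: (5 <= d); case: (6 <= d).
Qed.

(** [low_square] provides a vertex of degree at least 5, as [share_sum] requires. *)
Lemma quad_shares a b c d : tri b a -> face4 a b c d ->
  2 <= quad_share a b + quad_share b c + quad_share c d + quad_share d a.
Proof.
move=> t q0; have q1 := f4r q0; have q2 := f4r q1; have q3 := f4r q2.
have B0 : beside_tri a b by rewrite (face4_beside q0) t.
have B1 : beside_tri b c by rewrite (face4_beside q1) t !orbT.
have B2 : beside_tri c d by rewrite (face4_beside q2) t !orbT.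
have B3 : beside_tri d a by rewrite (face4_beside q3) t !orbT.
rewrite /quad_share (face4_quad q0) (face4_quad q1) (face4_quad q2) (face4_quad q3).
rewrite B0 B1 B2 B3 /=.
rewrite !(face4_count_step _ q2) !(face4_count_step _ q1) !(face4_count_step _ q0).
rewrite !(face4_count _ q0); apply: share_sum.
rewrite lt0n; apply/negP; rewrite !addn_eq0 !eqb0 -!ltnNge !ltnS.
case/andP=> /andP[/andP[da db] dc] dd.
by apply: (low_square e_sym e_irr L4 not_col crit rot_uniq rot_mem cycle5_triangle q0 t);
  apply/eqP; rewrite eqn_leq deg_ge4 andbT.
Qed.

Definition corner_share u v := quad_share u v + diamond_share u v.

Lemma share_le2 d n5 n6 : share d n5 n6 <= 2.
Proof. by rewrite /share; do !case: ifP. Qed.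

Lemma corner_share_quad u v : quad u v -> corner_share u v = quad_share u v.
Proof.
move=> q; rewrite /corner_share /diamond_share; case: ifP; rewrite ?addn0 //.
by case/andP=> t _; case: (tri_quadF t q).
Qed.

Lemma corner_share_nquad u v : ~~ quad u v -> corner_share u v = diamond_share u v.
Proof. by rewrite /corner_share /quad_share => /negbTE->. Qed.

(** Only one of the two sides of a 3-face at u can have another 3-face across it. *)
Lemma diamond_share_le1 u v : diamond_share u v <= 1.
Proof.
rewrite /diamond_share; case: ifP => // /andP[t _].
case t1: (tri v u); case t2: (tri u (r' u v)) => //.
have f : face3 (r' u v) u v.
  have E : r' u v = r v u by have [_ _ h] := f3P t; rewrite -{1}h rK.
  by rewrite E; exact: f3r (f3r t).
by have [] := tri_sides f t1; rewrite t2.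
Qed.

Lemma corner_share_le2 u v : corner_share u v <= 2.
Proof.
have [q|q] := boolP (quad u v).
  by rewrite corner_share_quad // /quad_share; case: ifP; rewrite ?share_le2.
by rewrite corner_share_nquad // (leq_trans (diamond_share_le1 _ _)).
Qed.

Lemma corner_share_deg4 u v : deg u = 4 -> corner_share u v = 0.
Proof.
move=> du; rewrite /corner_share /quad_share /diamond_share /share du /=.
by rewrite andbF; case: ifP.
Qed.

Lemma leq4P v : (5 <= deg v) = false -> deg v = 4.
Proof. by move=> h; apply/eqP; rewrite eqn_leq deg_ge4 andbT leqNgt h. Qed.

(** A 5-vertex pays 2 only to a 4-face on which all other vertices have degree 4. *)
Lemma corner_share_eq2 c b2 : deg c = 5 -> corner_share c b2 = 2 ->
  exists a1 b1, [/\ face4 c b2 a1 b1, beside_tri c b2,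
    deg b2 = 4, deg a1 = 4 & deg b1 = 4].
Proof.
move=> dc; have [q|q] := boolP (quad c b2); last first.
  by rewrite corner_share_nquad // => E; have := diamond_share_le1 c b2; rewrite E.
rewrite corner_share_quad // /quad_share q /=; case: ifP => // B.
exists (r b2 c), (r (r b2 c) b2); split => //; move: H;
  rewrite /share dc /= (face4_count (leq 5) q) dc /=;
  case: ifP => // _; rewrite -!addnA add1n eqSS !addn_eq0 !eqb0;
  case: ifP => // /and3P[/negbTE h1 /negbTE h2 /negbTE h3] _; exact: leq4P.
Qed.

(** Across the common side c b2 lies the other 4-face, so the 3-face is across one of the remaining
    three sides. *)
Lemma left_triI c b1 b2 b3 a1 a2 : face4 c b2 a1 b1 -> face4 c b3 a2 b2 ->
  beside_tri c b2 -> left_tri e rot a1 b2 b1 c.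
Proof.
move=> q1 q2; rewrite (face4_beside q1) => /or4P[] t.
- by case: (tri_quadF t (face4_quad (f4r (f4r (f4r q2))))).
- by constructor 1; exists (r b2 a1).
- by constructor 2; exists (r a1 b1).
- by constructor 3; exists (r b1 c).
Qed.

Lemma right_triI c b1 b2 b3 a1 a2 : face4 c b2 a1 b1 -> face4 c b3 a2 b2 ->
  beside_tri c b3 -> right_tri e rot a2 b2 b3 c.
Proof.
move=> q1 q2; rewrite (face4_beside q2) => /or4P[] t.
- by constructor 3; exists (r c b3).
- by constructor 2; exists (r b3 a2).
- by constructor 1; exists (r a2 b2).
- by case: (tri_quadF t (face4_quad q1)).
Qed.

Lemma corner_share_consecutive c w : deg c = 5 -> corner_share c w = 2 ->
  corner_share c (r c w) = 2 -> False.
Proof.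
move=> dc /(corner_share_eq2 dc)[a1 [b1 [q1 B1 dw da1 db1]]].
move=> /(corner_share_eq2 dc)[a2 [b2 [q2 B2 drw da2 db2]]].
have E : b2 = w by have [_ _ _] := f4P q2 => /(can_inj (rK c)).
rewrite {b2}E in q2 db2.
have t1 := left_triI q1 q2 B1; have t2 := right_triI q1 q2 B2.
exact: (domino_irreducible e_sym e_irr L4 not_col crit rot_uniq rot_mem
  cycle5_triangle q1 q2 t1 t2).
Qed.

(** Were the middle corner on a 4-face and paying, the vertex opposite to c would have degree
    exactly 5, which is the situation of [triple_irreducible]. A middle corner on a 3-face pays
    nothing, as 4-faces lie across both its sides at c. *)
Lemma corner_share_alternate c w : deg c = 5 -> corner_share c w = 2 ->
  corner_share c (r c (r c w)) = 2 -> corner_share c (r c w) = 0.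
Proof.
move=> dc C1 C3; have nC2 := corner_share_consecutive dc C1.
move: C1 C3 => /(corner_share_eq2 dc)[a1 [b1 [q1 B1 dw da1 db1]]].
move=> /(corner_share_eq2 dc)[a3 [b3 [q3 B3 db4 da3 db3]]].
have E : b3 = r c w by have [_ _ _] := f4P q3 => /(can_inj (rK c)).
rewrite {b3}E in q3 db3.
have nt1 : ~~ tri c w by apply/negP => t; case: (tri_quadF t (face4_quad q1)).
have nt3 : ~~ tri (r c w) c.
  by apply/negP; rewrite -tri_step => t; case: (tri_quadF t (face4_quad q3)).
have [q2|nq2] := boolP (quad c (r c w)); last first.
  rewrite corner_share_nquad // /diamond_share rK.
  by rewrite (negbTE nt1) (negbTE nt3); case: ifP.
rewrite corner_share_quad //; move: nC2; rewrite corner_share_quad // /quad_share q2.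
case: ifP => //= B2; set b3 := r c w in q3 db3 q2 B2 *.
set a2 := r b3 c.
have q2' : face4 c b3 a2 w.
  have [_ _ _ E] := f4P q2; have -> : w = r (r b3 c) b3 by apply: (can_inj (rK c)); rewrite E.
  exact: q2.
rewrite !(face4_count _ q2') /share dc dw db3 /= !addn0 !add0n.
case: ifP => // n6 n5; move: n6; rewrite lt0n eqb0 negbK => n6.
(* No vertex of this 4-face has degree at least 6, and c is not its only vertex of degree at least
   5, since the share is not 2. *)
have da2 : deg a2 = 5.
  apply/eqP; rewrite eqn_leq -ltnS ltnNge n6 /= ltnNge; apply/negP => d4.
  by move: n5; rewrite leqNgt ltnS d4 /=; apply.
have t2 : (exists x, face3 w a2 x) \/ (exists x, face3 a2 b3 x).
  move: B2; rewrite (face4_beside q2') => /or4P[] t.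
  - by rewrite t in nt3.
  - by right; exists (r b3 a2).
  - by left; exists (r a2 w).
  - by rewrite t in nt1.
have t1 := left_triI q1 q2' B1; have t3 := right_triI q2' q3 B3.
by case: (triple_irreducible e_sym e_irr L4 not_col crit rot_uniq rot_mem cycle5_triangle
  q1 q2' q3 t1 t3 t2).
Qed.

(** On a cycle of five there are at most two entries 2. If there are two, the entry between them is
    0 and the other two are at most 1; a single 2 leaves four entries at most 1. *)
Lemma five_corners (x0 x1 x2 x3 x4 : nat) :
  [&& x0 <= 2, x1 <= 2, x2 <= 2, x3 <= 2 & x4 <= 2] ->
  ~~ ((x0 == 2) && (x1 == 2)) -> ~~ ((x1 == 2) && (x2 == 2)) ->
  ~~ ((x2 == 2) && (x3 == 2)) -> ~~ ((x3 == 2) && (x4 == 2)) ->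
  ~~ ((x4 == 2) && (x0 == 2)) ->
  ((x0 == 2) && (x2 == 2) ==> (x1 == 0)) -> ((x1 == 2) && (x3 == 2) ==> (x2 == 0)) ->
  ((x2 == 2) && (x4 == 2) ==> (x3 == 0)) -> ((x3 == 2) && (x0 == 2) ==> (x4 == 0)) ->
  ((x4 == 2) && (x1 == 2) ==> (x0 == 0)) ->
  x0 + x1 + x2 + x3 + x4 <= 6.
Proof.
case: x0 => [|[|[|?]]] //; case: x1 => [|[|[|?]]] //; case: x2 => [|[|[|?]]] //;
by case: x3 => [|[|[|?]]] //; case: x4 => [|[|[|?]]].
Qed.

(** Each vertex pays at most its charge 6(d - 4). For d >= 6 this follows from 2d <= 6d - 24, a
    4-vertex pays nothing, and d = 5 is [five_corners]. *)
Lemma vertex_shares v : \sum_(w | e v w) corner_share v w + 24 <= 6 * deg v.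
Proof.
have [d6|] := leqP 6 (deg v).
  have: \sum_(w | e v w) corner_share v w <= \sum_(w | e v w) 2.
    by apply: leq_sum => w _; apply: corner_share_le2.
  have -> : \sum_(w | e v w) 2 = deg v * 2.
    by rewrite sum_nat_const -cardsE.
  lia.
rewrite ltnS leq_eqVlt => /orP[/eqP d5|]; last first.
  rewrite ltnS => d4; have {}d4 : deg v = 4 by apply/eqP; rewrite eqn_leq d4 deg_ge4.
  by rewrite big1 ?d4 // => w _; apply: corner_share_deg4.
have /card_gt0P[w0] : 0 < #|[set w | e v w]| by rewrite -/(deg v) d5.
rewrite inE => ew0; have := rho_deg5 rot_uniq rot_mem ew0 d5 => /=.
set w1 := r v w0; set w2 := r v w1; set w3 := r v w2; set w4 := r v w3 => -[w5 u M].
rewrite (eq_bigl (mem [:: w0; w1; w2; w3; w4])) // -big_uniq // !big_cons big_nil d5 /=.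
have A w : ~~ ((corner_share v w == 2) && (corner_share v (r v w) == 2)).
  by apply/negP => /andP[/eqP h1 /eqP h2]; apply: corner_share_consecutive h1 h2.
have B w : (corner_share v w == 2) && (corner_share v (r v (r v w)) == 2) ==>
    (corner_share v (r v w) == 0).
  by apply/implyP => /andP[/eqP h1 /eqP h2]; apply/eqP/corner_share_alternate.
have := @five_corners (corner_share v w0) (corner_share v w1) (corner_share v w2)
  (corner_share v w3) (corner_share v w4).
rewrite !corner_share_le2 => /(_ isT (A w0) (A w1) (A w2) (A w3)).
have := A w4; have := B w3; have := B w4; rewrite -/w4 w5 -/w1 => B4 B3 A4.
move=> /(_ A4 (B w0) (B w1) (B w2) B3 B4); clear; lia.
Qed.

Local Notation dart := {d : V * V | e d.1 d.2}.
Definition src (d : dart) := (val d).1.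
Definition tgt (d : dart) := (val d).2.
Lemma dart_e (d : dart) : e (src d) (tgt d). Proof. exact: (valP d). Qed.

Fact opp_subproof (d : dart) : e (tgt d, src d).1 (tgt d, src d).2.
Proof. by rewrite /= e_sym dart_e. Qed.
Definition opp (d : dart) : dart := Sub (tgt d, src d) (opp_subproof d).

Fact fstep_subproof (d : dart) :
  e (tgt d, r (tgt d) (src d)).1 (tgt d, r (tgt d) (src d)).2.
Proof. by rewrite /= r_adj e_sym dart_e. Qed.
Definition fstep (d : dart) : dart := Sub (tgt d, r (tgt d) (src d)) (fstep_subproof d).

Fact fback_subproof (d : dart) :
  e (r' (src d) (tgt d), src d).1 (r' (src d) (tgt d), src d).2.
Proof. by rewrite /= e_sym r'_adj dart_e. Qed.
Definition fback (d : dart) : dart := Sub (r' (src d) (tgt d), src d) (fback_subproof d).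

Lemma dart_eq (d d' : dart) : src d = src d' -> tgt d = tgt d' -> d = d'.
Proof.
move=> h1 h2; apply: val_inj; rewrite [val d]surjective_pairing [val d']surjective_pairing.
by congr (_, _).
Qed.

Lemma oppK : involutive opp. Proof. by move=> d; apply: dart_eq. Qed.
Lemma fstepK : cancel fstep fback. Proof. by move=> d; apply: dart_eq => //; apply: rK. Qed.
Lemma fbackK : cancel fback fstep. Proof. by move=> d; apply: dart_eq => //; apply: r'K. Qed.

Lemma sum_darts (F : V -> V -> nat) :
  \sum_(d : dart) F (src d) (tgt d) = \sum_v \sum_(w | e v w) F v w.
Proof.
rewrite pair_big_dep /=.
rewrite (reindex_omap (val : dart -> V * V) insub) /=; last by case=> u v /= ?; rewrite insubT.
by apply: eq_bigl => d; rewrite valK eqxx andbT; symmetry; apply: dart_e.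
Qed.

Lemma card_darts : #|{: dart}| = \sum_v deg v.
Proof.
rewrite -sum1_card (sum_darts (fun _ _ => 1)); apply: eq_bigr => v _.
by rewrite sum1_card -cardsE.
Qed.

Lemma beside_unique a b c d : face4 a b c d ->
  tri b a + tri c b + tri d c + tri a d <= 1.
Proof.
move=> q0; have q1 := f4r q0; have q2 := f4r q1; have q3 := f4r q2.
have U := @face4_face3_unique V e rot e_sym e_irr rot_uniq rot_mem deg_ge4 cycle5_triangle.
have N x y z w : face4 x y z w -> tri y x -> [&& ~~ tri z y, ~~ tri w z & ~~ tri x w].
  by move=> q t; have [h1 h2 h3] := U _ _ _ _ _ q t; apply/and3P; split; apply/negP; eauto.
have [t|nt0] := boolP (tri b a).
  by have /and3P[/negbTE-> /negbTE-> /negbTE->] := N _ _ _ _ q0 t.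
have [t|nt1] := boolP (tri c b).
  by have /and3P[/negbTE-> /negbTE-> _] := N _ _ _ _ q1 t.
have [t|nt2] := boolP (tri d c); last by case: (tri a d).
by have /and3P[/negbTE-> _ _] := N _ _ _ _ q2 t.
Qed.

Let T (d : dart) := tri (src d) (tgt d).
Let Q (d : dart) := quad (src d) (tgt d).
Let G (d : dart) := large (src d) (tgt d).
Let qs (d : dart) := quad_share (src d) (tgt d).
Let ds (d : dart) := diamond_share (src d) (tgt d).

Let T_fstep d : T (fstep d) = T d. Proof. exact: tri_step. Qed.
Let T_fback d : T (fback d) = T d. Proof. by rewrite -T_fstep fbackK. Qed.

(** For a common side t of two 3-faces, [s1 t] and [s2 t] are the darts found in [diamond_low_tail]
    and [diamond_low_head]. The two maps are inverse to each other, so no dart is called upon twice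
    by the same map. *)
Let s1 d := fback (opp (fback d)).
Let s2 d := fstep (opp (fstep d)).

(** The payers of the 2 due at the side t are, in order: a large face across it; the corners of a
    4-face across it; and, if a 3-face lies across, for the two ends of t either a large face
    through [s1] or [s2], or the end itself when its degree is at least 5. *)
Let side_pay t : 2 * T t <= 2 * (T t && G (opp t)) +
   (T t && Q (opp t)) * (qs (opp t) + qs (fstep (opp t)) + qs (fstep (fstep (opp t))) +
      qs (fstep (fstep (fstep (opp t))))) +
   (G (s1 t) && ~~ T (opp (s1 t))) + (G (s2 t) && ~~ T (opp (s2 t))) +
   [&& T t, T (opp t) & 5 <= deg (src t)] + [&& T t, T (opp t) & 5 <= deg (tgt t)].
Proof.
have [Tt|//] := boolP (T t); rewrite !andTb.
have [To|nTo] := boolP (T (opp t)); rewrite ?andTb ?andFb ?addn0.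
  have h1 : 1 <= (G (s1 t) && ~~ T (opp (s1 t))) + (5 <= deg (src t)).
    case h: (5 <= deg (src t)); first by rewrite addn1.
    by have [h1 h2] := diamond_low_tail Tt To (leq4P h); rewrite /G /T /= h1 h2.
  have h2 : 1 <= (G (s2 t) && ~~ T (opp (s2 t))) + (5 <= deg (tgt t)).
    case h: (5 <= deg (tgt t)); first by rewrite addn1.
    by have [h2 h3] := diamond_low_head Tt To (leq4P h); rewrite /G /T /= h2 h3.
  have R (A B c1 c2 x y : nat) : c1 + x + (c2 + y) <= A + B + c1 + c2 + x + y by lia.
  exact: leq_trans (leq_add h1 h2) (R _ _ _ _ _ _).
have [Qo|nQo] := boolP (Q (opp t)); last first.
  have -> : G (opp t).
    rewrite /G /large -/(T _) -/(Q _) nTo nQo dart_e /=.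
    by apply/negP; apply: tri_pent.
  by rewrite muln1 -!addnA leq_addr.
rewrite mul1n; apply: (@leq_trans (qs (opp t) + qs (fstep (opp t)) + qs (fstep (fstep (opp t))) +
      qs (fstep (fstep (fstep (opp t)))))); last by rewrite -!addnA; lia.
have [_ _ E _] := f4P Qo; have := quad_shares (a := tgt t) (b := src t) Tt Qo.
by rewrite -[X in _ + X](congr1 (quad_share _) E).
Qed.

(** Sum [side_pay] over all darts and reindex each term by the dart that pays. *)
Lemma discharge :
  \sum_(d : dart) 2 * tri (src d) (tgt d) <=
  \sum_(d : dart) 2 * large (src d) (tgt d) + \sum_(d : dart) corner_share (src d) (tgt d).
Proof.
have sumE (F : dart -> nat) (h h' : dart -> dart) : cancel h h' ->
    \sum_d F (h d) = \sum_d F d.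
  by move=> hK; rewrite [RHS](reindex_inj (can_inj hK)).
have s1K : cancel s1 (fun d => fstep (opp (fstep d))).
  by move=> d; rewrite /s1 fbackK oppK fbackK.
have s2K : cancel s2 (fun d => fback (opp (fback d))).
  by move=> d; rewrite /s2 fstepK oppK fstepK.
have H0 := @leq_sum dart (index_enum _) predT _ _ (fun t _ => side_pay t).
apply: (leq_trans H0); rewrite 5!big_split /= [X in _ <= _ + X]big_split /=.
have E1 : \sum_t 2 * (T t && G (opp t)) = \sum_d 2 * (T (opp d) && G d).
  rewrite -(sumE _ _ _ oppK); apply: eq_bigr => d _; by rewrite oppK.
have E2 : \sum_t (G (s1 t) && ~~ T (opp (s1 t))) = \sum_d (G d && ~~ T (opp d)).
  exact: (sumE (fun d => nat_of_bool (G d && ~~ T (opp d))) _ _ s1K).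
have E3 : \sum_t (G (s2 t) && ~~ T (opp (s2 t))) = \sum_d (G d && ~~ T (opp d)).
  exact: (sumE (fun d => nat_of_bool (G d && ~~ T (opp d))) _ _ s2K).
have E4 : \sum_t [&& T t, T (opp t) & 5 <= deg (tgt t)] =
    \sum_d [&& T (fback d), T (opp (fback d)) & 5 <= deg (tgt (fback d))].
  by rewrite -(sumE _ _ _ fbackK).
(* A dart of a large face pays 2 if a 3-face lies across it; otherwise at most 1 through [s1] and 1
   through [s2]. *)
have H1 : \sum_t 2 * (T t && G (opp t)) + \sum_t (G (s1 t) && ~~ T (opp (s1 t))) +
    \sum_t (G (s2 t) && ~~ T (opp (s2 t))) <= \sum_d 2 * G d.
  rewrite E1 E2 E3 -!big_split; apply: leq_sum => d _ /=.
  by case: (T (opp d)); case: (G d).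
have H2 : \sum_d [&& T d, T (opp d) & 5 <= deg (src d)] +
   \sum_d [&& T d, T (opp d) & 5 <= deg (tgt d)] <= \sum_d ds d.
  rewrite E4 -big_split; apply: leq_sum => d _ /=; rewrite T_fback.
  have -> : tgt (fback d) = src d by [].
  have -> : T (opp (fback d)) = tri (src d) (r' (src d) (tgt d)) by [].
  rewrite /ds /diamond_share -/(T d) -[tri (tgt d) _]/(T (opp d)).
  by case: (T d); case: (5 <= deg (src d)); rewrite ?andbT ?andbF.
(* Each corner of a 4-face is asked to pay once for every 3-face across a side; by [beside_unique]
   there is at most one. *)
have H3 : \sum_t (T t && Q (opp t)) * (qs (opp t) + qs (fstep (opp t)) +
      qs (fstep (fstep (opp t))) + qs (fstep (fstep (fstep (opp t))))) <= \sum_d qs d.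
  under eq_bigr do rewrite !mulnDr.
  rewrite !big_split /=.
  have R (h h' : dart -> dart) : cancel h h' -> cancel h' h ->
      \sum_t (T t && Q (opp t)) * qs (h (opp t)) =
      \sum_d (T (opp (h' d)) && Q (h' d)) * qs d.
    move=> hK h'K.
    rewrite -(sumE (fun t => (T t && Q (opp t)) * qs (h (opp t)))
      (fun d => opp (h' d)) (fun d => h (opp d))).
      by apply: eq_bigr => d _; rewrite oppK h'K.
    by move=> d; rewrite oppK h'K.
  rewrite (R id id) // (R fstep fback fstepK fbackK).
  rewrite (R (fun d => fstep (fstep d)) (fun d => fback (fback d))); last 2 first.
  - by move=> d; rewrite !fstepK.
  - by move=> d; rewrite !fbackK.
  rewrite (R (fun d => fstep (fstep (fstep d))) (fun d => fback (fback (fback d)))); last 2 first.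
  - by move=> d; rewrite !fstepK.
  - by move=> d; rewrite !fbackK.
  rewrite -!big_split; apply: leq_sum => d _ /=; rewrite -!mulnDl.
  have [q|nq] := boolP (Q d); last by rewrite /qs /quad_share -/(Q d) (negbTE nq) muln0.
  rewrite -[X in _ <= X]mul1n leq_mul2r; apply/orP; right.
  have [_ _ F3 F4] := f4P q; set w := r (tgt d) (src d) in F3 F4.
  set x := r w (tgt d) in F3 F4.
  have b1 : r' (src d) (tgt d) = x by rewrite -F4 rK.
  have b2 : r' x (src d) = w by rewrite -F3 rK.
  have b3 : r' w x = tgt d by rewrite rK.
  have -> : T (opp (fback (fback (fback d)))) = tri w (tgt d).
    rewrite -[LHS]/(tri (r' (r' (src d) (tgt d)) (src d))
      (r' (r' (r' (src d) (tgt d)) (src d)) (r' (src d) (tgt d)))).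
    by rewrite b1 b2 b3.
  have -> : T (opp (fback (fback d))) = tri x w.
    rewrite -[LHS]/(tri (r' (src d) (tgt d)) (r' (r' (src d) (tgt d)) (src d))).
    by rewrite b1 b2.
  have -> : T (opp (fback d)) = tri (src d) x.
    by rewrite -[LHS]/(tri (src d) (r' (src d) (tgt d))) b1.
  have := beside_unique q; rewrite -/w -/x -[tri (tgt d) _]/(T (opp d)).
  case: (T (opp d)); case: (tri w (tgt d)); case: (tri x w); case: (tri (src d) x) => //= _;
    by rewrite ?leq_b1 ?addn0 ?add0n ?leq_b1.
have R (A B c1 c2 x y A' q d : nat) : A + c1 + c2 <= A' -> x + y <= d -> B <= q ->
  A + B + c1 + c2 + x + y <= A' + (q + d) by lia.
exact: (R _ _ _ _ _ _ _ _ _ H1 H2 H3).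
Qed.

End Discharging.

(** * Euler's inequality *)

Section EulerInequality.
Variables (V D : finType) (src : D -> V) (opp phi : D -> D) (v0 : V).
Hypotheses (oppK : involutive opp) (opp_neq : forall d, opp d != d).
Hypothesis phi_inj : injective phi.
Hypothesis cycles_bound : forall P : D -> bool,
  (forall d, P (opp d) = P d) ->
  (forall v, \big[addb/false]_(d | src d == v) P d = false) ->
  exists f : D -> bool, (forall d, f (phi d) = f d) /\
    (forall d, f (opp d) = f d (+) P d).

(** One dart of each edge is selected, so that subsets of [O] are edge sets. *)
Let O := [set d | enum_rank d < enum_rank (opp d)].
Let edge_of (S : {set D}) d := (d \in S) (+) (opp d \in S).
(** The vertices of odd degree in S. The parity at v0 is left out because it is determined by the
    others: the degrees add up to an even number. *)
Let bd (S : {set D}) :=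
  [set v | (v != v0) && \big[addb/false]_(d | src d == v) edge_of S d].
Let sdiff (S S' : {set D}) := [set d | (d \in S) (+) (d \in S')].
Let faces := [set d | froots phi d].
Let separates (S X : {set D}) :=
  [forall d, edge_of S d == (froot phi d \in X) (+) (froot phi (opp d) \in X)].

Let opp_O d : (opp d \in O) = (d \notin O).
Proof.
rewrite !inE oppK -leqNgt [in RHS]leq_eqVlt.
by case: eqP => // /ord_inj/enum_rank_inj/eqP; rewrite (negbTE (opp_neq d)).
Qed.

Let edge_of_opp (S : {set D}) d : edge_of S (opp d) = edge_of S d.
Proof. by rewrite /edge_of oppK addbC. Qed.

Let edge_of_O (S : {set D}) d : S \subset O -> (d \in S) = (d \in O) && edge_of S d.
Proof.
move=> SO; rewrite /edge_of; have [dO|dO] := boolP (d \in O).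
  have -> : (opp d \in S) = false.
    by apply/negbTE; apply: contraL dO => /(subsetP SO); rewrite opp_O.
  by rewrite addbF.
by apply: contraNF dO => /(subsetP SO).
Qed.

Let edge_of_sdiff (S S' : {set D}) d : edge_of (sdiff S S') d = edge_of S d (+) edge_of S' d.
Proof.
rewrite /edge_of !inE.
by case: (d \in S); case: (d \in S'); case: (opp d \in S); case: (opp d \in S').
Qed.

Let even_total (S : {set D}) : \big[addb/false]_d edge_of S d = false.
Proof.
rewrite (bigID (mem O)) /= [X in _ (+) X](reindex_inj (can_inj oppK)) /=.
rewrite [X in _ (+) X](eq_big (mem O) (edge_of S)) ?addbb //.
by move=> d; rewrite opp_O negbK.
Qed.

(** Edge sets with the same odd vertices differ by an even edge set, which [cycles_bound] makes the
    boundary of a set of faces. *)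
Let sdiff_faces (S S' : {set D}) : S \subset O -> S' \subset O -> bd S = bd S' ->
  exists2 X : {set D}, X \subset faces & separates (sdiff S S') X.
Proof.
move=> SO S'O bdE.
have [||f [fphi fopp]] := cycles_bound (P := edge_of (sdiff S S')).
- by move=> d; apply: edge_of_opp.
- have bd0 v : v != v0 -> \big[addb/false]_(d | src d == v) edge_of (sdiff S S') d = false.
    move=> vv0; under eq_bigr do rewrite edge_of_sdiff.
    rewrite big_split /=; move/setP: bdE => /(_ v); rewrite !inE vv0 /= => ->.
    exact: addbb.
  move=> v; have [->|/bd0//] := eqVneq v v0.
  have := even_total (sdiff S S'); rewrite (partition_big src predT) //= (bigD1 v0) //=.
  by rewrite [X in _ (+) X]big1 ?addbF // => w /bd0.
have froot_f d : f (froot phi d) = f d.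
  have [n <-] : exists n, iter n phi d = froot phi d.
    by have /iter_findex <- := connect_root (frel phi) d; eexists.
  by elim: n => //= n IHn; rewrite fphi.
exists [set d in faces | f d]; first by apply/subsetP => d; rewrite inE => /andP[].
apply/forallP => d; rewrite !inE !froot_f !(roots_root (fconnect_sym phi_inj)) /=.
by rewrite fopp; case: (f d) (edge_of _ d) => [] [].
Qed.

(** An injection from edge sets to pairs of a vertex set off v0 and a set of faces gives 2^E <= 2^(V
    - 1) 2^F. The first component is [bd S]; the second is a set of faces separated by the
    difference between S and a fixed representative with the same [bd]. *)
Lemma euler_inequality : #|D| + 2 <= 2 * (#|V| + fcard phi D).
Proof.
have cardF : fcard phi D = #|faces|.
  by rewrite /n_comp_mem; apply: eq_card => d; rewrite !inE andbT.
have cardD : #|D| = 2 * #|O|.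
  rewrite -cardsT -(cardsID O) setTI mul2n -addnn; congr (_ + _).
  rewrite -(card_imset O (can_inj oppK)); apply: eq_card => d.
  by rewrite -[in RHS](oppK d) (mem_imset _ _ (can_inj oppK)) opp_O !inE andbT.
pose rep (Y : {set V}) := odflt set0 [pick S in powerset O | bd S == Y].
pose sep (S : {set D}) := odflt set0 [pick X in powerset faces | separates S X].
pose J S := (bd S, sep (sdiff S (rep (bd S)))).
have repP (S : {set D}) : S \subset O -> rep (bd S) \subset O /\ bd (rep (bd S)) = bd S.
  rewrite /rep => SO; case: pickP => [S' /=|/(_ S)]; last by rewrite inE SO eqxx.
  by rewrite inE => /andP[-> /eqP].
have sepP (S : {set D}) : S \subset O -> sep (sdiff S (rep (bd S))) \subset faces /\
    separates (sdiff S (rep (bd S))) (sep (sdiff S (rep (bd S)))).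
  move=> SO; have [RO bdR] := repP S SO; rewrite /sep.
  case: pickP => [X /=|]; first by rewrite inE => /andP[].
  have [X XF sX] := sdiff_faces SO RO (esym bdR).
  by move=> /(_ X); rewrite inE XF sX.
have Jinj : {in powerset O &, injective J}.
  move=> S S'; rewrite !powersetE => SO S'O JE.
  have bdE : bd S = bd S' := congr1 fst JE; have sepE := congr1 snd JE.
  have [_ /forallP h] := sepP S SO; have [_ /forallP h'] := sepP S' S'O.
  move: h h' sepE; rewrite /J /= -bdE => h h' sepE; apply/setP => d.
  rewrite (edge_of_O _ SO) (edge_of_O _ S'O); congr (_ && _).
  apply: (@addIb (edge_of (rep (bd S)) d)); rewrite -!edge_of_sdiff.
  by rewrite (eqP (h d)) (eqP (h' d)) sepE.
have : #|powerset O| <= #|setX (powerset [set~ v0]) (powerset faces)|.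
  rewrite -(card_in_imset Jinj); apply/subset_leq_card/subsetP => _ /imsetP[S SO ->].
  rewrite inE in SO; rewrite inE /= !inE (sepP S SO).1 andbT.
  by apply/subsetP => v; rewrite !inE => /andP[].
rewrite cardsX !card_powerset -expnD leq_exp2l // cardsC1 cardF cardD => leO.
have : 0 < #|V| by apply/card_gt0P; exists v0.
case: #|V| leO => //= n leO _.
by rewrite -[X in _ + X]muln1 -mulnDr leq_mul2l addn1 addSn ltnS.
Qed.

End EulerInequality.

(** * Euler's inequality against the discharging bound *)

Section NoCritical.
Variables (V : finType) (e : rel V) (C : finType) (L : V -> {set C}).
Hypotheses (e_sym : symmetric e) (e_irr : irreflexive e) (L4 : forall v, #|L v| = 4).
Hypotheses (not_col : ~ colorable_on e L setT)
  (crit : forall W : {set V}, W != setT -> colorable_on e L W).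
Variable rot : V -> seq V.
Hypotheses (rot_uniq : forall v, uniq (rot v)) (rot_mem : forall v w, (w \in rot v) = e v w).
Hypothesis cycle5_triangle : forall a b c d f y,
  uniq [:: a; b; c; d; f] -> e a b -> e b c -> e c d -> e d f -> e f a ->
  e a y -> e b y -> y = c \/ y = f.
Hypothesis cycles_bound : forall P : V -> V -> bool,
  (forall u v, P u v = P v u) ->
  (forall u, \big[addb/false]_(w | e u w) P u w = false) ->
  exists f : V -> V -> bool, forall u v, e u v ->
    f v u = f u v (+) P u v /\ f u (next (rot u) v) = f u v (+) P u v.

Local Notation dart := {d : V * V | e d.1 d.2}.
Notation src := (@src V e).
Notation tgt := (@tgt V e).
Notation opp := (opp e_sym).
Notation fstep := (fstep e_sym rot_mem).
Notation T := (tri e rot).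
Notation G := (large e rot).
Notation r := (rho rot).

Let fstep_inj : injective fstep := can_inj (fstepK e_sym rot_uniq rot_mem).

Let opp_neq d : opp d != d.
Proof.
apply/eqP => /(congr1 src) E; have := dart_e d.
by rewrite -[src d]E /src /tgt /= e_irr.
Qed.

Lemma dart_euler (v0 : V) : #|{: dart}| + 2 <= 2 * (#|V| + fcard fstep {: dart}).
Proof.
apply: (@euler_inequality V dart src opp fstep v0 (oppK e_sym) opp_neq fstep_inj).
(* Functions on darts are extended by [false] to non-adjacent pairs. *)
move=> P Popp Peven; pose Q u v := oapp P false (insub (u, v)).
have QE d : Q (src d) (tgt d) = P d.
  by rewrite /Q /src /tgt -surjective_pairing valK.
have [||f fP] := cycles_bound (P := Q).
- move=> u v; have [euv|neuv] := boolP (e u v); last first.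
    by rewrite /Q !insubF //=; apply/negbTE; rewrite // e_sym.
  pose d : dart := Sub (u, v) euv.
  by rewrite -[Q u v]/(Q (src d) (tgt d)) -[Q v u]/(Q (src (opp d)) (tgt (opp d))) !QE Popp.
- move=> u; rewrite -[RHS](Peven u).
  rewrite (reindex_omap tgt (fun w => insub (u, w))) /=; last first.
    by move=> w euw; rewrite insubT.
  have srcE d : e u (tgt d) && (insub (u, tgt d) == Some d) = (src d == u).
    apply/andP/eqP => [[eud]|<-].
      by rewrite insubT => /eqP[/(congr1 src)].
    rewrite dart_e -[X in insub X]surjective_pairing -/(val d) valK; split=> //.
  rewrite (eq_bigl _ _ srcE); apply: eq_bigr => d /eqP<-; exact: QE.
exists (fun d => f (src d) (tgt d)).
have fopp d : f (tgt d) (src d) = f (src d) (tgt d) (+) P d.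
  by have [-> _] := fP _ _ (dart_e d); rewrite QE.
split=> // d; have [_] := fP _ _ (dart_e (opp d)); rewrite QE Popp fopp.
by rewrite addbK.
Qed.

(** 6 per dart, corrected by the 2 that a side of a 3-face receives or a side of a large face gives.
    The total on a face is at least 24: 3 * 8, 4 * 6, 5 * 6, or at least 6 * 4. *)
Let k (d : dart) := if T (src d) (tgt d) then 8 else if G (src d) (tgt d) then 4 else 6.

Let fstep3 d : fstep (fstep (fstep d)) = d -> T (src d) (tgt d).
Proof.
set u := src d; set v := tgt d; set w := r v u => E.
have E1 : r w v = u := congr1 src E; have E2 : r (r w v) w = v := congr1 tgt E.
by rewrite E1 in E2; rewrite /tri /face3 dart_e -/u -/v -/w E1 E2 !eqxx.
Qed.

Let fstep4 d : fstep (fstep (fstep (fstep d))) = d -> quad e rot (src d) (tgt d).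
Proof.
set u := src d; set v := tgt d; set w := r v u; set x := r w v => E.
have E1 : r x w = u := congr1 src E; have E2 : r (r x w) x = v := congr1 tgt E.
by rewrite E1 in E2; rewrite /quad /face4 dart_e -/u -/v -/w -/x E1 E2 !eqxx.
Qed.

Let fstep5 d : fstep (fstep (fstep (fstep (fstep d)))) = d -> pent e rot (src d) (tgt d).
Proof.
set u := src d; set v := tgt d; set w := r v u; set x := r w v; set y := r x w => E.
have E1 : r y x = u := congr1 src E; have E2 : r (r y x) y = v := congr1 tgt E.
by rewrite E1 in E2; rewrite /pent /face5 dart_e -/u -/v -/w -/x -/y E1 E2 !eqxx.
Qed.

Let k_fstep d : k (fstep d) = k d.
Proof.
rewrite /k -[T (src (fstep d)) _]/(T (tgt d) (r (tgt d) (src d))).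
rewrite -[G (src (fstep d)) _]/(G (tgt d) (r (tgt d) (src d))).
by rewrite (tri_step e_sym rot_uniq rot_mem) (large_step e_sym rot_uniq rot_mem).
Qed.

Let deg_ge4 := critical_deg_ge4 e_sym e_irr L4 not_col crit.

Lemma face_weight d : 24 <= order fstep d * k d.
Proof.
have := iter_order fstep_inj d; have := order_gt0 fstep d.
have k4 : 4 <= k d by rewrite /k; case: ifP => //; case: ifP.
case: (order fstep d) => [|[|[|[|[|[|n]]]]]] //= _ E.
- have := adj_neq e_irr (dart_e d); rewrite -{1}E /src /tgt /= -/(tgt d).
  by rewrite -/(tgt d) eqxx.
- have := rho_neq rot_uniq rot_mem deg_ge4 (etrans (e_sym _ _) (dart_e d)).
  by have -> : r (tgt d) (src d) = src d := congr1 src E; rewrite eqxx.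
- by rewrite /k (fstep3 E).
- rewrite /k /large (fstep4 E) /= !andbF; by case: ifP.
- rewrite /k /large (fstep5 E) /= !andbF; by case: ifP.
- by rewrite (leq_trans _ (leq_mul (leqnn n.+4.+2) k4)) // mulnC leq_pmul2l.
Qed.

Lemma faces_weight : 24 * fcard fstep {: dart} <= \sum_d k d.
Proof.
rewrite (partition_big (froot fstep) (froots fstep)) /=; last first.
  by move=> d _; apply: roots_root; apply: fconnect_sym.
rewrite mulnC /n_comp_mem.
have -> : #|predI (froots fstep) (mem {: dart})| = #|froots fstep|.
  by apply: eq_card => d; rewrite !inE andbT.
rewrite -sum_nat_const; apply: leq_sum => x rx.
apply: leq_trans (face_weight x) _.
have -> : \sum_(d | froot fstep d == x) k d = \sum_(d | froot fstep d == x) k x.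
  apply: eq_bigr => d /eqP <-.
  have [n <-] : exists n, iter n fstep d = froot fstep d.
    by have /iter_findex <- := connect_root (frel fstep) d; eexists.
  by elim: n => //= n ->; rewrite k_fstep.
rewrite sum_nat_const leq_mul2r; apply/orP; right.
apply: subset_leq_card; apply/subsetP => d xd.
rewrite unfold_in /= -(rootP (fconnect_sym fstep_inj) xd).
exact: rx.
Qed.

Lemma no_critical_graph : False.
Proof.
(* Euler's inequality needs a vertex; the empty graph is colourable. *)
have [v0] : exists v0 : V, true.
  case: (pickP V) => [v _|V0]; first by exists v.
  have F (v : V) : False by have := V0 v.
  by case: not_col; exists (fun v => False_rect C (F v)); split => v; case: (F v).
move=> _; have := dart_euler v0; have := faces_weight.
have K : \sum_d k d + \sum_(d : dart) 2 * G (src d) (tgt d) =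
    6 * #|{: dart}| + \sum_(d : dart) 2 * T (src d) (tgt d).
  rewrite -sum1_card big_distrr -!big_split; apply: eq_bigr => d _ /=.
  rewrite /k; case: ifP => t; last by case: ifP.
  by rewrite /large t /= andbF.
have := discharge e_sym e_irr L4 not_col crit rot_uniq rot_mem cycle5_triangle.
have : \sum_v (\sum_(w | e v w) corner_share e rot v w + 24) <= \sum_v 6 * deg e v.
  apply: leq_sum => v _.
  exact: (vertex_shares e_sym e_irr L4 not_col crit rot_uniq rot_mem cycle5_triangle).
rewrite big_split /= -big_distrr /= -card_darts -sum_darts sum_nat_const.
move: K; rewrite -/G -/T.
set s1 := \sum_d k d; set s2 := \sum_d _; set s3 := \sum_d _; set s4 := \sum_d _.
set cD := #|{: dart}|; set cF := fcard _ _; set cV := #|V|.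
move=> K H1 H2 H3 H4.
(* The four bounds combine to 12|D| + 24 <= 24(|V| + F) <= 12|D|. *)
clearbody s1 s2 s3 s4 cD cF cV; lia.
Qed.

End NoCritical.

(** * Rotation systems of grid minors *)

Section CornerLabels.
Variable D : Type.
Implicit Types (f P : D -> bool) (v w : bool) (s t : seq D).

(* f labels each dart by a bit attached to the corner preceding it; crossing a
   dart of P flips the bit, starting from v and ending at w. *)
Fixpoint corner_run f P v s w :=
  if s is d :: s' then (f d == v) && corner_run f P (v (+) P d) s' w else v == w.

Lemma corner_run_cat f P v s t w :
  corner_run f P v (s ++ t) w -> exists2 u, corner_run f P v s u & corner_run f P u t w.
Proof.
elim: s v => [|d s IHs] v /=; first by exists v.
by move=> /andP[fd /IHs[u su tu]]; exists u; rewrite ?fd.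
Qed.

Lemma cat_corner_run f P v u w s t :
  corner_run f P v s u -> corner_run f P u t w -> corner_run f P v (s ++ t) w.
Proof.
elim: s v => [|d s IHs] v /=; first by move/eqP->.
by move=> /andP[-> su] /(IHs _ su) ->.
Qed.

End CornerLabels.

Lemma eq_in_corner_run (D : eqType) (f P P' : D -> bool) v s w : {in s, P =1 P'} ->
  corner_run f P v s w = corner_run f P' v s w.
Proof.
elim: s v => //= d s IHs v PP'; rewrite PP' ?mem_head // IHs // => x xs.
by rewrite PP' // inE xs orbT.
Qed.

(** A closed run may be started at any entry, so the list can be rotated to begin with x. *)
Lemma corner_run_next (D : eqType) (f P : D -> bool) v s x : uniq s -> corner_run f P v s v ->
  x \in s -> f (next s x) = f x (+) P x.
Proof.
move=> us rs xs; case/rot_to: (xs) => i t st.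
have [u] : exists u, corner_run f P u (x :: t) u.
  rewrite -st /seq.rot; have := rs; rewrite -{1}(cat_take_drop i s).
  by move=> /corner_run_cat[u ru ru']; exists u; apply: cat_corner_run ru.
rewrite -(next_rot i us) st /= => /andP[/eqP fx].
case: t st => [|y t] st /=; first by rewrite eqxx => /eqP; rewrite fx.
by rewrite eqxx fx => /andP[/eqP].
Qed.

(** * Contraction and deletion preserve sphericity *)

Section Contraction.
Variables (T D : eqType) (src tgt : D -> T) (alpha : D -> D) (E : pred D).
Hypotheses (alphaK : involutive alpha) (src_alpha : forall d, src (alpha d) = tgt d).
Hypothesis E_alpha : forall d, E (alpha d) = E d.

(* lab sends each vertex to the name of its class after contracting some edges;
   rot lists the remaining darts around each class. The last clause says that the
   underlying surface is a sphere: every even edge set is a boundary. *)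
Definition spherical (lab : T -> T) (rot : T -> seq D) : Prop :=
  [/\ forall x, uniq (rot x),
      forall x d, d \in rot x -> lab (src d) = x,
      forall d, E d -> lab (src d) != lab (tgt d) -> d \in rot (lab (src d))
    & forall P : D -> bool, (forall d, P (alpha d) = P d) ->
        (forall x, \big[addb/false]_(d <- rot x) P d = false) ->
        exists f : D -> bool, forall x,
          {in rot x, forall d, f (alpha d) = f d (+) P d} /\
          exists v, corner_run f P v (rot x) v].

Let tgt_alpha d : tgt (alpha d) = src d. Proof. by rewrite -src_alpha alphaK. Qed.

(** If the rotations at the ends of d0 are s1 d0 s2 and t1 d0' t2, with d0' the reverse of d0, the
    merged vertex gets s1 t2 t1 s2. An even set of the contracted graph becomes even in the old one
    once d0 is put in or left out suitably, and the labels bounding it there still serve. *)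
Lemma contract_spherical lab rot d0 : spherical lab rot -> E d0 ->
    lab (src d0) != lab (tgt d0) ->
  exists rot', spherical
    (fun x => if lab x == lab (tgt d0) then lab (src d0) else lab x) rot'.
Proof.
move=> [rot_uniq rot_src rot_mem hom] E0.
set p := lab (src d0); set q := lab (tgt d0) => pq.
have d0p : d0 \in rot p by apply: rot_mem.
have d1q : alpha d0 \in rot q.
  by rewrite /q -src_alpha; apply: rot_mem; rewrite ?E_alpha // src_alpha tgt_alpha eq_sym.
have [s1 [s2 rotp]] : exists s1 s2, rot p = s1 ++ d0 :: s2 by case/splitPr: d0p; eauto.
have [t1 [t2 rotq]] : exists t1 t2, rot q = t1 ++ alpha d0 :: t2 by case/splitPr: d1q; eauto.
pose rot' x := if x == p then s1 ++ t2 ++ t1 ++ s2 else if x == q then [::] else rot x.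
have st_perm : perm_eq (d0 :: alpha d0 :: (s1 ++ t2 ++ t1 ++ s2)) (rot p ++ rot q).
  by apply/permP => a; rewrite rotp rotq /= ?count_cat /= ?count_cat /=; lia.
have : uniq (rot p ++ rot q).
  rewrite cat_uniq !rot_uniq andbT /=; apply/hasPn => d /rot_src dq.
  by apply/negP => /rot_src; rewrite dq => /esym/eqP; rewrite (negbTE pq).
rewrite -(perm_uniq st_perm) !cons_uniq inE negb_or.
case/and3P => /andP[d01 d0st] d1st ust.
have st_mem d : (d \in rot p ++ rot q) = [|| d == d0, d == alpha d0 | d \in s1 ++ t2 ++ t1 ++ s2].
  by rewrite -(perm_mem st_perm) !inE.
exists rot'; split.
- by move=> x; rewrite /rot'; case: ifP => // _; case: ifP.
- move=> x d; rewrite /rot'; case: ifP => [/eqP-> dst|xp].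
    have : d \in rot p ++ rot q by rewrite st_mem dst !orbT.
    by rewrite mem_cat => /orP[] /rot_src ->; rewrite ?(negbTE pq) ?eqxx.
  by case: ifP => // xq /rot_src ->; rewrite xq.
- move=> d Ed ldd.
  have nd0 : d != d0 by apply: contraNneq ldd => ->; rewrite -/p -/q (negbTE pq) eqxx.
  have nd1 : d != alpha d0.
    by apply: contraNneq ldd => ->; rewrite src_alpha tgt_alpha -/p -/q (negbTE pq) eqxx.
  have {}ldd : lab (src d) != lab (tgt d) by apply: contraNneq ldd => ->.
  have dm := rot_mem d Ed ldd.
  have dst : (lab (src d) == p) || (lab (src d) == q) -> d \in s1 ++ t2 ++ t1 ++ s2.
    move=> h; have : d \in rot p ++ rot q.
      by rewrite mem_cat; case/orP: h => /eqP <-; rewrite dm ?orbT.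
    by rewrite st_mem (negbTE nd0) (negbTE nd1).
  rewrite /rot'; case: (eqVneq (lab (src d)) q) => [lq|nq].
    by rewrite eqxx dst // lq eqxx orbT.
  by case: (eqVneq (lab (src d)) p) dst => [_ -> //|_ _]; rewrite (negbTE nq).
- move=> P Pa Peven.
  (* The membership of d0 that makes p even; evenness of the merged vertex makes it right for q as
     well. *)
  pose c := \big[addb/false]_(d <- s1 ++ s2) P d.
  pose P1 d := if (d == d0) || (d == alpha d0) then c else P d.
  have P1E (s : seq D) : d0 \notin s -> alpha d0 \notin s -> {in s, P1 =1 P}.
    move=> h0 h1 d ds; rewrite /P1; case: eqP => [E1|_]; first by rewrite -E1 ds in h0.
    by case: eqP => [E1|_] //; rewrite -E1 ds in h1.
  move: d0st d1st; rewrite !mem_cat !negb_or.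
  move=> /and4P[a1 a2 a3 a4] /and4P[b1 b2 b3 b4].
  have ct : \big[addb/false]_(d <- t1 ++ t2) P d = c.
    have := Peven p; rewrite /rot' eqxx /c !big_cat /=.
    by do 4!case: (\big[addb/false]_(d <- _) P d).
  have bigP1 (s : seq D) : d0 \notin s -> alpha d0 \notin s ->
      \big[addb/false]_(d <- s) P1 d = \big[addb/false]_(d <- s) P d.
    by move=> h0 h1; apply: eq_big_seq; apply: P1E.
  have P1d0 : P1 d0 = c by rewrite /P1 eqxx.
  have P1d1 : P1 (alpha d0) = c by rewrite /P1 eqxx orbT.
  have other x : x != p -> x != q -> d0 \notin rot x /\ alpha d0 \notin rot x.
    move=> xp xq; split; apply/negP => /rot_src; rewrite ?src_alpha => E1.
      by rewrite -E1 eqxx in xp.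
    by rewrite -E1 eqxx in xq.
  have [||f fP] := hom P1.
  + move=> d; rewrite /P1 Pa (can2_eq alphaK alphaK) (inj_eq (can_inj alphaK)).
    by rewrite orbC.
  + move=> x; have [->|xp] := eqVneq x p.
      rewrite rotp big_cat big_cons /= !bigP1 // P1d0 /c big_cat /=.
      by do 2!case: (\big[addb/false]_(d <- _) P d).
    have [->|xq] := eqVneq x q.
      rewrite rotq big_cat big_cons /= !bigP1 // P1d1 -ct big_cat /=.
      by do 2!case: (\big[addb/false]_(d <- _) P d).
    have [h0 h1] := other x xp xq; rewrite bigP1 //; have := Peven x.
    by rewrite /rot' (negbTE xp) (negbTE xq).
  exists f => x; rewrite /rot'; case: (eqVneq x p) => [_|xp].
    split.
      move=> d dst; have : d \in rot p ++ rot q by rewrite st_mem dst !orbT.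
      have P1d : P1 d = P d.
        by apply: (P1E (s1 ++ t2 ++ t1 ++ s2) _ _ d dst); rewrite !mem_cat !negb_or; apply/and4P.
      by rewrite mem_cat -P1d => /orP[] dr; [apply: (fP p).1 | apply: (fP q).1].
    have [_ [v]] := fP p; have [_ [w]] := fP q.
    rewrite rotp rotq => /corner_run_cat[w' tw /= /andP[/eqP fd1 wt]].
    move=> /corner_run_cat[v' sv /= /andP[/eqP fd0 vs]].
    have fd01 : f (alpha d0) = f d0 (+) c by rewrite -P1d0; apply: (fP p).1.
    (* The label after d0 is the one before its reverse, and conversely, so the two runs can be cut
       at d0 and spliced. *)
    have E1 : w' (+) P1 (alpha d0) = v' by rewrite -fd1 P1d1 fd01 fd0 addbK.
    have E2 : v' (+) P1 d0 = w' by rewrite -fd0 P1d0 -fd01 fd1.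
    rewrite E1 in wt; rewrite E2 in vs; exists v.
    rewrite -(eq_in_corner_run f v v (P1E (s1 ++ t2 ++ t1 ++ s2) _ _)); last 2 first.
    - by rewrite !mem_cat !negb_or; exact/and4P.
    - by rewrite !mem_cat !negb_or; exact/and4P.
    exact: cat_corner_run sv (cat_corner_run wt (cat_corner_run tw vs)).
  case: (eqVneq x q) => [_|xq]; first by split=> //; exists true.
  have [h0 h1] := other x xp xq; have [fx [v rv]] := fP x.
  split; first by move=> d dx; rewrite fx // (P1E _ h0 h1).
  by exists v; rewrite -(eq_in_corner_run f v v (P1E _ h0 h1)).
Qed.

(** The darts of [ds] are contracted one by one, skipping those whose ends are already merged. Only
    vertices with the same value of [c] are ever merged. *)
Lemma merge_along (V : eqType) (c : T -> option V) (ds : seq D) rot0 :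
    spherical id rot0 ->
    {in ds, forall d, [/\ E d, c (src d) = c (tgt d) & c (src d) != None]} ->
  exists lab rot, [/\ spherical lab rot, {in ds, forall d, lab (src d) = lab (tgt d)}
    & forall x y, lab x = lab y -> x = y \/ c x = c y /\ c x != None].
Proof.
move=> good0; elim: ds => [|d ds IHds] dsP.
  by exists id, rot0; split=> // x y; left.
have [|lab [rot [glr labds labc]]] := IHds.
  by move=> d' d'ds; apply: dsP; rewrite inE d'ds orbT.
have [Ed cd cdN] := dsP d (mem_head _ _).
have [labd|labd] := eqVneq (lab (src d)) (lab (tgt d)).
  by exists lab, rot; split=> // d'; rewrite inE => /predU1P[->|/labds].
have [rot' glr'] := contract_spherical glr Ed labd.
pose lab' x := if lab x == lab (tgt d) then lab (src d) else lab x.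
have srcN x : lab x = lab (src d) -> c x = c (src d).
  by case/labc=> [->|[]].
have tgtN x : lab x = lab (tgt d) -> c x = c (src d).
  by rewrite cd; case/labc=> [->|[]].
exists lab', rot'; split=> //.
  move=> d'; rewrite inE /lab' => /predU1P[->|/labds ->] //.
  by rewrite eqxx (negbTE labd).
move=> x y; rewrite /lab'; case: eqP => [lx|_]; case: eqP => [ly|_].
- by move=> _; right; rewrite !tgtN.
- by move=> /esym ly; right; rewrite tgtN // srcN.
- by move=> lx; right; rewrite [c y]tgtN // srcN.
- exact: labc.
Qed.

(** The fibres of [c] are the branch sets, [ds] is contracted, and all remaining darts except those
    of [edge] are deleted by [pmap]. An even set P of the minor is lifted to Q, which is false on
    the deleted darts. *)
Lemma minor_rotation (V : finType) (e : rel V) (c : T -> option V) (root : V -> T)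
    (edge : V -> V -> D) (ds : seq D) (rot0 : T -> seq D) :
    irreflexive e -> symmetric e -> spherical id rot0 ->
    (forall u v, e u v -> [/\ E (edge u v), c (src (edge u v)) = Some u,
       c (tgt (edge u v)) = Some v & edge v u = alpha (edge u v)]) ->
    {in ds, forall d, [/\ E d, c (src d) = c (tgt d) & c (src d) != None]} ->
    (forall lab : T -> T, {in ds, forall d, lab (src d) = lab (tgt d)} ->
       forall u v, e u v -> lab (src (edge u v)) = lab (root u)) ->
  exists rot : V -> seq V,
    [/\ forall v, uniq (rot v), forall v w, (w \in rot v) = e v w
      & forall P : V -> V -> bool, (forall u v, P u v = P v u) ->
          (forall u, \big[addb/false]_(w | e u w) P u w = false) ->
          exists f : V -> V -> bool, forall u v, e u v ->
            f v u = f u v (+) P u v /\ f u (next (rot u) v) = f u v (+) P u v].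
Proof.
move=> e_irr e_sym good0 edgeP dsP conn.
have [lab [rotT [glr labds labc]]] := merge_along good0 dsP.
have [rotT_uniq rotT_src rotT_mem hom] := glr; have labE := conn lab labds.
have edge_inj u v u' v' : e u v -> e u' v' -> edge u v = edge u' v' -> u = u' /\ v = v'.
  move=> /edgeP[_ cu cv _] /edgeP[_ cu' cv' _] E1.
  by move: cu cv; rewrite E1 cu' cv' => -[->] [->].
pose nb u d := [pick v | e u v && (edge u v == d)].
have nbP u v : e u v -> nb u (edge u v) = Some v.
  rewrite /nb => euv; case: pickP => [w /andP[euw /eqP E1]|/(_ v)].
    by have [_ ->] := edge_inj _ _ _ _ euw euv E1.
  by rewrite euv eqxx.
have nbK u : ocancel (nb u) (edge u).
  by move=> d; rewrite /nb; case: pickP => //= v /andP[_ /eqP].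
pose rot u := pmap (nb u) (rotT (lab (root u))).
have edge_rot u v : e u v -> edge u v \in rotT (lab (root u)).
  move=> euv; have [Ed cu cv _] := edgeP _ _ euv; rewrite -(labE _ _ euv).
  apply: rotT_mem => //; apply/eqP => /labc[] E1.
    by move: cv; rewrite -E1 cu => -[uv]; move: euv; rewrite uv e_irr.
  by move: E1.1; rewrite cu cv => -[uv]; move: euv; rewrite uv e_irr.
have rot_uniq u : uniq (rot u) by apply: (pmap_uniq (nbK u)).
have rot_mem u v : (v \in rot u) = e u v.
  rewrite mem_pmap; apply/mapP/idP => [[d _]|euv].
    by rewrite /nb; case: pickP => // w /andP[euw _] [->].
  by exists (edge u v); rewrite ?nbP ?edge_rot.
exists rot; split=> // P Psym Peven.
pose Q d := [exists uv : V * V, [&& e uv.1 uv.2, edge uv.1 uv.2 == d & P uv.1 uv.2]].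
have QE u v : e u v -> Q (edge u v) = P u v.
  move=> euv; apply/existsP/idP => [[[u' v'] /= /and3P[euv' /eqP E1]]|Puv].
    by have [-> ->] := edge_inj _ _ _ _ euv' euv E1.
  by exists (u, v); rewrite /= euv eqxx.
have Qa d : Q (alpha d) = Q d.
  suff h d' : Q d' -> Q (alpha d') by apply/idP/idP => /h; rewrite ?alphaK.
  move=> /existsP[[u v] /= /and3P[euv /eqP <- Puv]].
  have [_ _ _ <-] := edgeP _ _ euv.
  by apply/existsP; exists (v, u); rewrite /= e_sym euv eqxx Psym.
have Qnb u v d : e u v -> d \in rotT (lab (root u)) -> Q d -> nb u d != None.
  move=> euv dr /existsP[[u' v'] /= /and3P[euv' /eqP E1 _]].
  have [_ cu _ _] := edgeP _ _ euv; have [_ cu' _ _] := edgeP _ _ euv'.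
  have lu : lab (src (edge u v)) = lab (src (edge u' v')).
    by rewrite (labE _ _ euv) E1; symmetry; apply: rotT_src.
  have uu : u = u'.
    by apply: Some_inj; rewrite -cu -cu'; case/labc: lu => [->|[]].
  by rewrite -E1 -uu nbP // uu.
have rotQ u v : e u v -> \big[addb/false]_(d <- rotT (lab (root u))) Q d =
     \big[addb/false]_(w <- rot u) P u w.
  move=> euv; have h := Qnb u v _ euv.
  suff R s : {subset s <= rotT (lab (root u))} ->
      \big[addb/false]_(d <- s) Q d = \big[addb/false]_(w <- pmap (nb u) s) P u w.
    exact: R.
  elim: s => [|d s IHs] sub /=; first by rewrite !big_nil.
  rewrite big_cons IHs; last by move=> d' d's; apply: sub; rewrite inE d's orbT.
  have := h d; rewrite sub ?mem_head // => /(_ isT).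
  rewrite /nb; case: pickP => [w /andP[euw /eqP <-] _|_] /=.
    by rewrite big_cons QE.
  by case: (Q d) => //= /(_ isT).
have [||f fP] := hom Q.
- exact: Qa.
- move=> x.
  have [/existsP[[u v] /= /andP[euv /eqP <-]]|nx] :=
      boolP [exists uv : V * V, e uv.1 uv.2 && (lab (root uv.1) == x)].
    rewrite (rotQ _ _ euv) -[RHS](Peven u) big_uniq //; apply: eq_bigl => w.
    exact: rot_mem.
  rewrite big_seq big1 // => d dx; apply/negbTE; apply: contra nx.
  move=> /existsP[[u v] /= /and3P[euv /eqP dE _]]; apply/existsP; exists (u, v).
  by rewrite /= euv -(labE _ _ euv) dE (rotT_src _ _ dx) /=.
exists (fun u v => f (edge u v)) => u v euv.
have [fa [w rw]] := fP (lab (root u)).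
have [_ _ _ ->] := edgeP _ _ euv; rewrite fa ?edge_rot // QE //; split=> //.
have : corner_run (fun v => f (edge u v)) (P u) w (rot u) w.
  have h := Qnb u v _ euv.
  (* Deleted darts are outside Q, so skipping them leaves the running bit unchanged. *)
  suff R s w' : {subset s <= rotT (lab (root u))} -> corner_run f Q w' s w ->
      corner_run (fun v => f (edge u v)) (P u) w' (pmap (nb u) s) w.
    exact: R.
  elim: s w' => //= d s IHs w' sub /andP[fd ws].
  have sub' : {subset s <= rotT (lab (root u))} by move=> d' d's; apply: sub; rewrite inE d's orbT.
  have := h d; rewrite sub ?mem_head // => /(_ isT).
  rewrite /nb; case: pickP => [w2 /andP[euw /eqP dE] _|_ Qd] /=.
    by rewrite dE fd -(QE _ _ euw) dE; apply: IHs.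
  apply: IHs => //; move: ws; have -> : Q d = false by case: (Q d) Qd => // /(_ isT).
  by rewrite addbF.
by move=> /(corner_run_next (rot_uniq u)); apply; rewrite rot_mem.
Qed.

End Contraction.

(** * The grid on the quarter plane is spherical *)

Section Grid.
Local Notation cell := (nat * nat)%type.
Implicit Types (p q : cell) (d : cell * cell).

Definition grid_adj d := let: ((i, j), (k, l)) := d in
  [|| (k == i.+1) && (l == j), (k == i) && (l == j.+1),
      (i == k.+1) && (l == j) | (k == i) && (j == l.+1)].

Definition grid_rot p : seq (cell * cell) := let: (i, j) := p in
  [:: (p, (i.+1, j)); (p, (i, j.+1))] ++
  (if i is i'.+1 then [:: (p, (i', j))] else [::]) ++
  (if j is j'.+1 then [:: (p, (i, j'))] else [::]).

Lemma mem_grid_rot p d : (d \in grid_rot p) = (d.1 == p) && grid_adj d.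
Proof.
case: p d => i j [[i1 j1] [k l]] /=; rewrite !inE !mem_cat /= !xpair_eqE.
have -> : (((i1, j1), (k, l)) \in (if i is i'.+1 then [:: ((i, j), (i', j))] else [::])) =
    [&& i1 == i, j1 == j, i == k.+1 & l == j].
  by case: i => [|i]; rewrite ?inE ?xpair_eqE ?andbF ?andbA // eqSS [i == k]eq_sym.
have -> : (((i1, j1), (k, l)) \in (if j is j'.+1 then [:: ((i, j), (i, j'))] else [::])) =
    [&& i1 == i, j1 == j, k == i & j == l.+1].
  by case: j => [|j]; rewrite ?inE ?xpair_eqE ?andbF ?andbA // eqSS [j == l]eq_sym.
case: (eqVneq i1 i) => [->|] //=; case: (eqVneq j1 j) => [->|] //=.
Qed.

Lemma grid_spherical :
  spherical (@fst cell cell) (@snd cell cell) (fun d => (d.2, d.1)) grid_adj id grid_rot.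
Proof.
split.
- case=> i j /=; case: i => [|i]; case: j => [|j];
  rewrite /= ?inE ?xpair_eqE ?eqxx /= ?(gtn_eqF (ltnSn _)) ?(ltn_eqF (ltnSn _)) /=
    ?andbF ?andbT //=; lia.
- by move=> p d; rewrite mem_grid_rot => /andP[/eqP].
- by move=> d Ed _; rewrite mem_grid_rot eqxx.
move=> P Pa Peven.
pose h i j := P ((i, j), (i.+1, j)); pose v i j := P ((i, j), (i, j.+1)).
have hE i j : P ((i.+1, j), (i, j)) = h i j by rewrite -Pa.
have vE i j : P ((i, j.+1), (i, j)) = v i j by rewrite -Pa.
(* [G i j] labels the unit square with upper right corner (i, j): the parity of the vertical edges
   of P to its left in the same row. The outer face is met at i = 0 or j = 0, with label [false]. *)
pose G i j := if j is j'.+1 then \big[addb/false]_(k < i) v k j' else false.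
have Gb i : G i 0 = false by [].
have G0 j : G 0 j = false by case: j => [|j] //=; rewrite big_ord0.
have GN' i j : G i.+1 j.+1 = G i j.+1 (+) v i j by rewrite /G big_ord_recr.
have GN i j : G i.+1 j.+1 (+) v i j = G i j.+1 by rewrite GN' addbK.
have even i j : h i j (+) v i j (+) (if i is i'.+1 then h i' j else false)
    (+) (if j is j'.+1 then v i j' else false) = false.
  rewrite -[RHS](Peven (i, j)) /= !big_cons -/(h i j) -/(v i j) big_cat /=.
  by case: i => [|i]; case: j => [|j]; rewrite ?big_cons ?big_nil ?hE ?vE ?addbF ?addbA.
(* Crossing a horizontal edge also flips the label as P says. This goes by induction on the column,
   evenness at (i, j) relating each horizontal edge to the one on its left. *)
have GE i j : G i.+1 j (+) h i j = G i.+1 j.+1.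
  have := even i j; elim: i => [|i IHi] ev.
    case: j ev => [|j]; rewrite ?GN' ?G0 ?Gb /=.
      by case: (h 0 0); case: (v 0 0).
    by case: (h 0 j.+1); case: (v 0 j.+1); case: (v 0 j).
  have {IHi} := IHi (even i j); case: j ev => [|j] ev IHj; rewrite [RHS]GN' -IHj.
    by move: ev; rewrite !Gb; case: (h i.+1 0); case: (v i.+1 0); case: (h i 0).
  rewrite [G i.+2 _]GN'; move: ev.
  by case: (h i.+1 j.+1); case: (v i.+1 j.+1); case: (h i j.+1); case: (v i.+1 j);
     case: (G i.+1 j.+1).
(* [grid_rot] is counterclockwise, so the corner before a dart lies in the square on its right. *)
pose f d := let: ((i, j), (k, l)) := d in
  if i < k then G i.+1 j else if j < l then G i.+1 j.+1 else if k < i then G i j.+1 else G i j.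
have f1 i j : f ((i, j), (i.+1, j)) = G i.+1 j by rewrite /f ltnSn.
have f2 i j : f ((i, j), (i, j.+1)) = G i.+1 j.+1 by rewrite /f ltnn ltnSn.
have f3 i j : f ((i.+1, j), (i, j)) = G i.+1 j.+1.
  by rewrite /f ltnNge leqnSn ltnn ltnSn.
have f4 i j : f ((i, j.+1), (i, j)) = G i j.+1.
  by rewrite /f !ltnn ltnNge leqnSn.
clearbody f G; exists f => -[i j]; split.
  move=> [[i1 j1] [k l]]; rewrite mem_grid_rot => /andP[/eqP[-> ->]] /=.
  case/or4P=> /andP[/eqP E1 /eqP E2]; subst.
  + by rewrite f1 f3 GE.
  + by rewrite f2 f4 GN.
  + by rewrite f1 f3 hE -[X in _ = X (+) _]GE addbK.
  + by rewrite f2 f4 vE GN'.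
exists (G i.+1 j); rewrite /= f1 f2 -/(h _ _) -/(v _ _) !eqxx /= GE eqxx /= GN.
(* On the border a dart is missing, but the labels on both sides of the gap are those of the outer
   face. *)
have bottom : G i j.+1 (+) (if i is i'.+1 then h i' j else false) = G i j.
  by case: i => [|i]; rewrite ?G0 // -GE addbK.
have last_step :
    corner_run f P (G i j) (if j is j'.+1 then [:: ((i, j), (i, j'))] else [::]) (G i.+1 j).
  case: j {bottom} => [|j] /=; first by rewrite !Gb.
  by rewrite f4 eqxx /= vE GN'.
case: i bottom last_step => [|i] /= bottom; first by rewrite addbF in bottom; rewrite bottom.
by rewrite f3 eqxx /= hE bottom.
Qed.

End Grid.

(* W u v is a grid walk drawing the edge uv from u; its steps up to 2K lie near
   u, those from 2K to 4K are interior, and step 4K belongs to the part near v. *)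
Record grid_drawing (V : finType) (e : rel V) (K : nat) (W : V -> V -> nat -> nat * nat)
    (root : V -> nat * nat) : Prop := GridDrawing {
  walk_root : forall u v, e u v -> W u v 0 = root u;
  walk_step : forall u v j, e u v -> j < 4 * K ->
    W u v j = W u v j.+1 \/ grid_adj (W u v j, W u v j.+1);
  walk_meet : forall u v, e u v -> W u v (4 * K) = W v u (2 * K);
  walk_ends : forall u v u' v' j j', e u v -> e u' v' -> u != u' ->
    j <= 2 * K -> j' <= 2 * K -> W u v j != W u' v' j';
  walk_end_middle : forall u v u' v' j j', e u v -> e u' v' -> u' != u -> u' != v ->
    2 * K <= j <= 4 * K -> j' <= 2 * K -> W u v j != W u' v' j';
  walk_middles : forall u v u' v' j j', e u v -> e u' v' ->
    [set u; v] != [set u'; v'] ->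
    2 * K <= j <= 4 * K -> 2 * K <= j' <= 4 * K -> W u v j != W u' v' j' }.

Lemma grid_drawing_sub (V : finType) (e : rel V) K W root (S : {set V}) :
  grid_drawing e K W root ->
  grid_drawing (fun u v : {x | x \in S} => e (val u) (val v)) K
    (fun u v => W (val u) (val v)) (fun u => root (val u)).
Proof.
case=> h1 h2 h3 h4 h5 h6; split.
- by move=> u v; apply: h1.
- by move=> u v; apply: h2.
- by move=> u v; apply: h3.
- by move=> u v u' v' j j' euv eu'v' uu'; apply: h4.
- by move=> u v u' v' j j' euv eu'v' uu' uv'; apply: h5.
move=> u v u' v' j j' euv eu'v' uv; apply: h6 => //; apply: contra uv => /eqP E.
have E' : val @: [set u; v] = val @: [set u'; v'] by rewrite !imsetU1 !imset_set1.
by apply/eqP; apply: (imset_inj val_inj).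
Qed.

(** * The graph as a minor of the grid *)

Section GridDrawing.
Variables (V : finType) (e : rel V) (K : nat) (W : V -> V -> nat -> nat * nat)
  (root : V -> nat * nat).
Hypotheses (e_sym : symmetric e) (e_irr : irreflexive e).
Hypothesis drawing : grid_drawing e K W root.

Let W_root := walk_root drawing.
Let W_step := walk_step drawing.
Let W_meet := walk_meet drawing.
Let W_ends := walk_ends drawing.
Let W_end_middle := walk_end_middle drawing.
Let W_middles := walk_middles drawing.

(** [inB u] holds near u, and [inM u] on the middles of the edges from u to vertices of higher rank,
    so each middle goes to one end. The branch map [c] prefers [inB] where both apply. *)
Let inB u p := [exists v, e u v && has (fun j => W u v j == p) (iota 0 (2 * K).+1)].
Let inM u p := [exists v, [&& e u v, enum_rank u < enum_rank v &
  has (fun j => W u v j == p) (iota (2 * K) (2 * K).+1)]].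
Let c p := if [pick u | inB u p] is Some u then Some u else [pick u | inM u p].

Let inBP u p : reflect (exists v j, [/\ e u v, j <= 2 * K & W u v j = p]) (inB u p).
Proof.
apply: (iffP existsP) => [[v /andP[euv /hasP[j]]]|[v [j [euv jK E]]]].
  by rewrite mem_iota => jK /eqP; exists v, j.
by exists v; rewrite euv; apply/hasP; exists j; rewrite ?E // mem_iota.
Qed.

Let inMP u p : reflect (exists v j, [/\ e u v, enum_rank u < enum_rank v,
  2 * K <= j <= 4 * K & W u v j = p]) (inM u p).
Proof.
apply: (iffP existsP) => [[v /and3P[euv uv /hasP[j]]]|[v [j [euv uv jK E]]]].
  rewrite mem_iota => jK /eqP; exists v, j; split=> //; lia.
exists v; rewrite euv uv; apply/hasP; exists j; rewrite ?E //.
by rewrite mem_iota; lia.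
Qed.

Let inB_inj u u' p : inB u p -> inB u' p -> u = u'.
Proof.
move=> /inBP[v [j [euv jK <-]]] /inBP[v' [j' [euv' jK' E]]].
by apply/eqP; apply: contraT => uu'; have := W_ends euv euv' uu' jK jK'; rewrite E eqxx.
Qed.

Let inM_inj u u' p : inM u p -> inM u' p -> u = u'.
Proof.
move=> /inMP[v [j [euv uv jK <-]]] /inMP[v' [j' [euv' uv' jK' E]]].
have [S|S] := eqVneq [set u; v] [set u'; v']; last first.
  by have := W_middles euv euv' S jK jK'; rewrite E eqxx.
have : u \in [set u'; v'] by rewrite -S !inE eqxx.
rewrite !inE => /orP[/eqP//|/eqP uv1].
have : v \in [set u'; v'] by rewrite -S !inE eqxx orbT.
rewrite !inE => /orP[/eqP vu'|/eqP vv1].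
  by move: uv uv'; rewrite uv1 vu'; lia.
by move: euv; rewrite uv1 vv1 e_irr.
Qed.

Let c_inB u p : inB u p -> c p = Some u.
Proof.
move=> up; rewrite /c; case: pickP => [u' u'p|/(_ u)]; last by rewrite up.
by rewrite (inB_inj u'p up).
Qed.

Let c_inM u p : inM u p -> (forall u', inB u' p -> u' = u) -> c p = Some u.
Proof.
move=> up h; rewrite /c; case: pickP => [u' /h -> //|_].
case: pickP => [u' u'p|/(_ u)]; last by rewrite up.
by rewrite (inM_inj u'p up).
Qed.

(** Where the walk first enters the part near v. The step into it becomes the edge uv of the minor,
    and everything before it belongs to u. *)
Let first u v := find (fun j => inB v (W u v j)) (iota 0 (4 * K).+1).

Let firstP u v : e u v -> enum_rank u < enum_rank v ->
  [/\ 0 < first u v <= 4 * K, inB v (W u v (first u v))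
    & forall j, j < first u v -> c (W u v j) = Some u].
Proof.
move=> euv uv; have evu : e v u by rewrite e_sym.
have vu : v != u by apply: contraTneq euv => ->; rewrite e_irr.
have hasf : has (fun j => inB v (W u v j)) (iota 0 (4 * K).+1).
  apply/hasP; exists (4 * K); first by rewrite mem_iota add0n ltnSn.
  by rewrite W_meet //; apply/inBP; exists u, (2 * K).
have ltf : first u v < (4 * K).+1 by have := hasf; rewrite has_find size_iota.
have fB : inB v (W u v (first u v)).
  by have := nth_find 0 hasf; rewrite -/(first u v) nth_iota // add0n.
have nB j : j < first u v -> ~~ inB v (W u v j).
  move=> jf; have := before_find 0 jf; rewrite nth_iota ?add0n; last by apply: ltn_trans ltf.
  by move/negbT.
split=> //.
  rewrite -[first u v <= _]ltnS ltf andbT lt0n; apply/eqP => f0.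
  have := inB_inj (u := u) _ fB; rewrite f0 => /(_ (introT (inBP _ _) _)) h.
  by case/eqP: vu; rewrite h //; exists v, 0.
(* A cell beyond 2K lies on the middle of uv. It can be near no vertex other than u and v, and it is
   not near v before [first]. *)
move=> j jf; have [jK|jK] := leqP j (2 * K).
  by apply: c_inB; apply/inBP; exists v, j.
have jK4 : 2 * K <= j <= 4 * K by move: jK jf ltf; lia.
apply: c_inM; first by apply/inMP; exists v, j.
move=> u' /inBP[v' [j' [eu'v' j'K E]]]; apply/eqP; apply: contraT => u'u.
have [u'v|u'v] := eqVneq u' v.
  by have := nB j jf; rewrite -{1}u'v => /inBP[]; exists v', j'.
by have := W_end_middle euv eu'v' u'u u'v jK4 j'K; rewrite E eqxx.
Qed.

Let half_edge u v := (W u v (first u v).-1, W u v (first u v)).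
Let edge u v := if enum_rank u < enum_rank v then half_edge u v
  else ((half_edge v u).2, (half_edge v u).1).

Let half_edgeP u v : e u v -> enum_rank u < enum_rank v ->
  [/\ grid_adj (half_edge u v), c (half_edge u v).1 = Some u & c (half_edge u v).2 = Some v].
Proof.
move=> euv uv; have [/andP[f0 fK] fB cu] := firstP euv uv.
have c1 : c (W u v (first u v).-1) = Some u by apply: cu; rewrite prednK.
have c2 := c_inB fB; split=> //=.
have [|E|] := @W_step u v (first u v).-1 euv; rewrite ?prednK //.
have uv' : u != v by apply: contraTneq euv => ->; rewrite e_irr.
by move: c1; rewrite E prednK // c2 => -[/eqP]; rewrite eq_sym (negbTE uv').
Qed.

(** The edges to contract are the proper steps of the walks that stay in one branch set; along them
    every branch set used is joined to its root. *)
Let all_steps := [seq (W uv.1 uv.2 j, W uv.1 uv.2 j.+1)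
  | uv <- enum {: V * V}, j <- iota 0 (4 * K)].
Let ds := [seq d <- all_steps | [&& grid_adj d, c d.1 == c d.2 & c d.1 != None]].

Let lab_walk (lab : nat * nat -> nat * nat) :
    {in ds, forall d, lab d.1 = lab d.2} ->
  forall u v n, e u v -> n <= 4 * K -> (forall j, j <= n -> c (W u v j) = Some u) ->
  lab (W u v n) = lab (root u).
Proof.
move=> labds u v; elim=> [|n IHn] euv nK cW; first by rewrite W_root.
rewrite -IHn //; [|lia|by move=> j jn; apply: cW; apply: leq_trans jn _].
have [<- //|adj] := W_step euv (nK : n < 4 * K).
symmetry; apply: (labds (W u v n, W u v n.+1)).
rewrite mem_filter; apply/andP; split; first by apply/and3P; split; rewrite /= ?cW.
by apply/allpairsP; exists ((u, v), n); rewrite /= mem_enum mem_iota.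
Qed.

Lemma grid_drawing_rotation : exists rot : V -> seq V,
    [/\ forall v, uniq (rot v), forall v w, (w \in rot v) = e v w
      & forall P : V -> V -> bool, (forall u v, P u v = P v u) ->
          (forall u, \big[addb/false]_(w | e u w) P u w = false) ->
          exists f : V -> V -> bool, forall u v, e u v ->
            f v u = f u v (+) P u v /\ f u (next (rot u) v) = f u v (+) P u v].
Proof.
have adjC d : grid_adj (d.2, d.1) = grid_adj d.
  by case: d => [[i j] [k l]] /=; rewrite ![_ == i]eq_sym ![_ == j]eq_sym; lia.
apply: (@minor_rotation _ _ fst snd (fun d => (d.2, d.1)) grid_adj _ _ adjC
  V e c root edge ds grid_rot e_irr e_sym grid_spherical) => //.
- by case.
- move=> u v euv; have evu : e v u by rewrite e_sym.
  rewrite /edge; case: (ltngtP (enum_rank u) (enum_rank v)) => [uv|vu|].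
  + by have [h1 h2 h3] := half_edgeP euv uv; split.
  + have [h1 h2 h3] := half_edgeP evu vu; split=> //; first by rewrite adjC.
  + by move=> /ord_inj/enum_rank_inj uv; move: euv; rewrite uv e_irr.
- by move=> d; rewrite mem_filter => /andP[/and3P[-> /eqP-> ->]].
move=> lab labds u v euv; have evu : e v u by rewrite e_sym.
rewrite /edge; case: (ltngtP (enum_rank u) (enum_rank v)) => [uv|vu|].
- have [/andP[f0 fK] fB cu] := firstP euv uv.
  apply: (lab_walk labds) => //; first by lia.
  by move=> j jf; apply: cu; lia.
- have [/andP[f0 fK] fB cu] := firstP evu vu.
  (* Seen from the higher end u, the dart starts in the part near u, from where some walk of u leads
     back to the root. *)
  rewrite /half_edge /=; case/inBP: fB => w [j [euw jK <-]].
  apply: (lab_walk labds) => //; first by lia.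
  by move=> i ij; apply: c_inB; apply/inBP; exists w, i; split=> //; apply: leq_trans ij jK.
by move=> /ord_inj/enum_rank_inj uv; move: euv; rewrite uv e_irr.
Qed.

End GridDrawing.

(** * From plane drawings to grid drawings *)

Require Import Defs.
From HB Require Import structures.
From mathcomp Require Import all_order all_algebra ring lra.
From mathcomp Require Import all_classical all_reals all_analysis.

Import Order.TTheory GRing.Theory Num.Theory.
Import numFieldNormedType.Exports.
Local Open Scope classical_set_scope.
Local Open Scope ring_scope.

Section Curves.
Variable R : realType.
Implicit Types (f g : R -> R * R) (x y s t : R).

Lemma near_curve f x (eps : R) : {within `[0, 1], continuous f} ->
  `[0, 1]%classic x -> 0 < eps ->
  \forall y \near x, `[0, 1]%classic y -> `|f x - f y| < eps.
Proof.
move=> /subspace_continuousP cf x01 e0.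
by have := cf x x01; move=> /cvgrPdist_lt /(_ _ e0).
Qed.

Lemma curve_uniform f (eps : R) : {within `[0, 1], continuous f} -> 0 < eps ->
  \forall d \near (0:R)^'+, forall x, `[0, 1]%classic x ->
    forall y, `[0, 1]%classic y -> `|x - y| < d -> `|f x - f y| < eps.
Proof.
move=> cf e0; have e2 : 0 < eps / 2 by rewrite divr_gt0.
have /compact_near_coveringP/near_covering_withinP cov := @segment_compact R 0 1.
apply: (cov _ _ (fun d x => forall y, `[0, 1]%classic y -> `|x - y| < d -> `|f x - f y| < eps)).
move=> x x01; have /nbhs_ballP[r /= r0 fr] := near_curve cf x01 e2.
have r2 : 0 < r / 2 by rewrite divr_gt0.
near=> x' d => /= x'01 y y01 x'y.
have xx' : `|x - x'| < r / 2 by near: x'; apply: nbhsx_ballx.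
have d2 : d < r / 2 by near: d; apply: nbhs_right_lt.
have h1 : `|f x - f x'| < eps / 2 by apply: fr => //; rewrite /ball /=; lra.
have h2 : `|f x - f y| < eps / 2.
  apply: fr => //; rewrite /ball /=.
  have := ler_distD x' x y; lra.
have := ler_distD (f x) (f x') (f y); rewrite (distrC (f x') (f x)); lra.
Unshelve. all: end_near. Qed.

(** The distance is positive at each pair of parameters; compactness of the two segments, used in
    turn, makes the bound uniform. *)
Lemma curves_apart f g (a b c d : R) :
  {within `[0, 1], continuous f} -> {within `[0, 1], continuous g} ->
  0 <= a -> b <= 1 -> 0 <= c -> d <= 1 ->
  (forall s t, `[a, b]%classic s -> `[c, d]%classic t -> f s <> g t) ->
  \forall h \near (0:R)^'+, forall s, `[a, b]%classic s ->
    forall t, `[c, d]%classic t -> h <= `|f s - g t|.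
Proof.
move=> cf cg a0 b1 c0 d1 fg.
have sub s : `[a, b]%classic s -> `[0, 1]%classic s by rewrite /= !in_itv /=; lra.
have sub' s : `[c, d]%classic s -> `[0, 1]%classic s by rewrite /= !in_itv /=; lra.
have /compact_near_coveringP/near_covering_withinP cov := @segment_compact R a b.
have /compact_near_coveringP/near_covering_withinP cov' := @segment_compact R c d.
apply: (cov R ((0:R)^'+) (fun h s => forall t, `[c, d]%classic t -> h <= `|f s - g t|)) => s sab.
suff: \forall p \near (nbhs s, (0:R)^'+), forall t, `[c, d]%classic t ->
    `[a, b]%classic p.1 -> p.2 <= `|f p.1 - g t|.
  by apply: filterS => -[s' h] /= H s'ab t tcd; apply: H.
apply: (cov' (R * R)%type (filter_prod (nbhs s) (0:R)^'+)
  (fun p t => `[a, b]%classic p.1 -> p.2 <= `|f p.1 - g t|)) => t tcd.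
have e0 : 0 < `|f s - g t| by rewrite normr_gt0 subr_eq0; apply/eqP/fg.
have e3 : 0 < `|f s - g t| / 3 by rewrite divr_gt0.
have /nbhs_ballP[r1 /= r10 fr] := near_curve cf (sub _ sab) e3.
have /nbhs_ballP[r2 /= r20 gr] := near_curve cg (sub' _ tcd) e3.
near=> t' p => /= t'cd pab.
have h1 : `|f s - f p.1| < `|f s - g t| / 3.
  apply: fr; last exact: sub.
  near: p; exists (ball s r1, setT); last by case=> ? ? [].
  by split; [exact: nbhsx_ballx | exact: filterT].
have h2 : `|g t - g t'| < `|f s - g t| / 3.
  apply: gr; last exact: sub'.
  by near: t'; apply: nbhsx_ballx.
have h3 : p.2 < `|f s - g t| / 3.
  near: p; exists (setT, [set h | h < `|f s - g t| / 3]); last by case=> ? ? [].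
  by split; [exact: filterT | exact: nbhs_right_lt].
have := ler_distD (f p.1) (f s) (g t); have := ler_distD (g t') (f p.1) (g t).
rewrite (distrC (g t') (g t)); lra.
Unshelve. all: end_near. Qed.

Lemma curve_bounded f : {within `[0, 1], continuous f} ->
  exists M, forall s, `[0, 1]%classic s -> `|f s| <= M.
Proof.
move=> cf; have := continuous_compact cf (@segment_compact R 0 1).
case/compact_bounded => M [_ HM]; exists (M + 1) => s s01.
by apply: (HM (M + 1)); [rewrite ltrDl | exists s].
Qed.

End Curves.

Lemma truncn_eq_dist (R : realType) (x y : R) : 0 <= x -> 0 <= y ->
  Num.truncn x = Num.truncn y -> `|x - y| < 1.
Proof.
move=> /truncn_itv/andP[x1 x2] /truncn_itv/andP[y1 y2] E.
rewrite E in x1 x2; rewrite -natr1 in x2 y2; rewrite ltr_distl; lra.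
Qed.

Lemma truncn_step (R : realType) (x y : R) : 0 <= x -> 0 <= y -> `|x - y| < 1 ->
  [\/ Num.truncn x = Num.truncn y, Num.truncn x = (Num.truncn y).+1
    | Num.truncn y = (Num.truncn x).+1].
Proof.
move=> /truncn_itv/andP[x1 x2] /truncn_itv/andP[y1 y2]; rewrite ltr_distl => /andP[h1 h2].
have : (Num.truncn x < (Num.truncn y).+2)%N.
  by rewrite -(@ltr_nat R); rewrite -!natr1 in x2 y2 *; lra.
have : (Num.truncn y < (Num.truncn x).+2)%N.
  by rewrite -(@ltr_nat R); rewrite -!natr1 in x2 y2 *; lra.
move=> a b.
have [E|E|E] := ltngtP (Num.truncn x) (Num.truncn y).
- by constructor 3; lia.
- by constructor 2; lia.
- by constructor 1.
Qed.

Lemma near_implies (T : Type) (F : set_system T) (FF : Filter F) (b : bool) (P : T -> Prop) :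
  (b -> \forall h \near F, P h) -> \forall h \near F, b -> P h.
Proof.
case: b => [H|_]; last by apply: filterE.
by apply: filterS (H isT) => h ? _.
Qed.

Section Discretize.
Variables (R : realType) (V : finType) (e : rel V) (pos : V -> R * R)
  (arc : V -> V -> R -> R * R).
Hypothesis drawing : plane_drawing e pos arc.

Let arc_cont u v : e u v -> {within `[0, 1], continuous (arc u v)}.
Proof. by case: drawing => _ arcP _ _ /arcP[]. Qed.

Let arc0 u v : e u v -> arc u v 0 = pos u.
Proof. by case: drawing => _ arcP _ _ /arcP[]. Qed.

Let arc_rev u v (t : R) : e u v -> 0 <= t <= 1 -> arc v u t = arc u v (1 - t).
Proof. by case: drawing => _ arcP _ _ /arcP[_ _ _ _ h] t01; apply: h; rewrite in_itv. Qed.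

Let arc_inj u v (s t : R) : e u v -> 0 <= s <= 1 -> 0 <= t <= 1 ->
  arc u v s = arc u v t -> s = t.
Proof. by case: drawing => _ arcP _ _ /arcP[_ h _ _ _] s01 t01; apply: h; rewrite in_itv. Qed.

Let arc_vertex u v w (t : R) : e u v -> 0 < t < 1 -> arc u v t <> pos w.
Proof. by case: drawing => _ _ h _ euv t01; apply: h; rewrite ?in_itv. Qed.

Let arc_cross u v u' v' (s t : R) : e u v -> e u' v' -> [set u; v]%SET <> [set u'; v']%SET ->
  0 < s < 1 -> 0 < t < 1 -> arc u v s <> arc u' v' t.
Proof. by case: drawing => _ _ _ h euv euv' S s01 t01; apply: h; rewrite ?in_itv. Qed.

Let sep_ends u v u' v' (s t : R) : e u v -> e u' v' -> u != u' ->
  0 <= s <= 3^-1 -> 0 <= t <= 3^-1 -> arc u v s <> arc u' v' t.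
Proof.
move=> euv euv' uu' s3 t3.
have [->|s0] := eqVneq s 0.
  rewrite arc0 //; have [->|t0] := eqVneq t 0.
    rewrite arc0 //; case: drawing => pos_inj _ _ _ /pos_inj E.
    by rewrite E eqxx in uu'.
  by apply/nesym/arc_vertex => //; lra.
have [->|t0] := eqVneq t 0; first by rewrite [arc u' v' 0]arc0 //; apply: arc_vertex => //; lra.
have [S|/eqP S] := eqVneq [set u; v]%SET [set u'; v']%SET; last by apply: arc_cross => //; lra.
have : u \in [set u'; v']%SET by rewrite -S !inE eqxx.
rewrite !inE (negbTE uu') /= => /eqP uv1.
have : u' \in [set u; v]%SET by rewrite S !inE eqxx.
rewrite !inE eq_sym (negbTE uu') /= => /eqP uv2.
(* Both arcs draw the same edge from opposite ends: the reversed parameter 1 - t is at least 2/3,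
   beyond s. *)
rewrite -uv1 uv2 [arc v u t](arc_rev euv); last by lra.
by move=> E; have := @arc_inj u v s (1 - t) euv; rewrite E => /(_ _ _ erefl); lra.
Qed.

Let sep_end_middle u v u' v' (s t : R) : e u v -> e u' v' -> u' != u -> u' != v ->
  3^-1 <= s <= 2 / 3 -> 0 <= t <= 3^-1 -> arc u v s <> arc u' v' t.
Proof.
move=> euv euv' u'u u'v s3 t3.
have [->|t0] := eqVneq t 0; first by rewrite [arc u' v' 0]arc0 //; apply: arc_vertex => //; lra.
apply: arc_cross => //; [|lra|lra] => S.
have : u' \in [set u; v]%SET by rewrite S !inE eqxx.
by rewrite !inE (negbTE u'u) (negbTE u'v).
Qed.

Let apart (h : R) u v u' v' (a b c d : R) := forall s : R, `[a, b]%classic s ->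
  forall t, `[c, d]%classic t -> h <= `|arc u v s - arc u' v' t|.

Let near_apart u v u' v' (a b c d : R) : e u v -> e u' v' -> 0 <= a -> b <= 1 -> 0 <= c -> d <= 1 ->
  (forall s t, a <= s <= b -> c <= t <= d -> arc u v s <> arc u' v' t) ->
  \forall h \near (0:R)^'+, apart h u v u' v' a b c d.
Proof.
move=> euv euv' a0 b1 c0 d1 H; by apply: curves_apart => //; apply: arc_cont.
Qed.

Let separated (h : R) := forall i : (V * V) * (V * V), e i.1.1 i.1.2 -> e i.2.1 i.2.2 ->
  [/\ i.1.1 != i.2.1 -> apart h i.1.1 i.1.2 i.2.1 i.2.2 0 3^-1 0 3^-1,
      (i.2.1 != i.1.1) && (i.2.1 != i.1.2) ->
        apart h i.1.1 i.1.2 i.2.1 i.2.2 3^-1 (2 / 3) 0 3^-1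
    & [set i.1.1; i.1.2]%SET != [set i.2.1; i.2.2]%SET ->
        apart h i.1.1 i.1.2 i.2.1 i.2.2 3^-1 (2 / 3) 3^-1 (2 / 3)].

Let near_separated : \forall h \near (0:R)^'+, separated h.
Proof.
have third0 : 0 <= 3^-1 :> R by lra.
have third1 : 3^-1 <= 1 :> R by lra.
have third2 : 2 / 3 <= 1 :> R by lra.
apply: filter_forall => -[[u v] [u' v']] /=.
apply: near_implies => euv; apply: near_implies => euv'.
have H1 : \forall h \near (0:R)^'+, u != u' -> apart h u v u' v' 0 3^-1 0 3^-1.
  apply: near_implies => uu'; apply: near_apart => // s t.
  exact: sep_ends.
have H2 : \forall h \near (0:R)^'+, (u' != u) && (u' != v) ->
    apart h u v u' v' 3^-1 (2 / 3) 0 3^-1.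
  apply: near_implies => /andP[? ?]; apply: near_apart => // s t.
  exact: sep_end_middle.
have H3 : \forall h \near (0:R)^'+, [set u; v]%SET != [set u'; v']%SET ->
    apart h u v u' v' 3^-1 (2 / 3) 3^-1 (2 / 3).
  apply: near_implies => /eqP S; apply: near_apart => // s t s3 t3.
  by apply: arc_cross => //; clear S; lra.
near=> h; split.
- by near: h.
- by near: h.
- by near: h.
Unshelve. all: end_near. Qed.

Let uniform (h d : R) := forall uv : V * V, e uv.1 uv.2 ->
  forall x : R, `[0, 1]%classic x -> forall y, `[0, 1]%classic y -> `|x - y| < d ->
    `|arc uv.1 uv.2 x - arc uv.1 uv.2 y| < h.

Let near_uniform h : 0 < h -> \forall d \near (0:R)^'+, uniform h d.
Proof.
move=> h0; apply: filter_forall => -[u v] /=; apply: near_implies => euv.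
exact: curve_uniform (arc_cont euv) h0.
Qed.

Let bounded : exists M : R, forall u v, e u v ->
  forall s : R, `[0, 1]%classic s -> `|arc u v s| <= M.
Proof.
have : \forall M \near +oo, forall uv : V * V, e uv.1 uv.2 ->
    forall s : R, `[0, 1]%classic s -> `|arc uv.1 uv.2 s| <= M.
  apply: filter_forall => -[u v] /=; apply: near_implies => euv.
  have [M0 HM0] := curve_bounded (arc_cont euv).
  near=> M => s s01; apply: le_trans (HM0 _ s01) _.
  by near: M; apply: nbhs_pinfty_ge; rewrite num_real.
move=> /filter_ex[M HM]; exists M => u v euv; exact: (HM (u, v)).
Unshelve. all: end_near. Qed.

Let half_le (K j : nat) : (j <= 4 * K -> j./2 <= 3 * K)%N.
Proof. clear; lia. Qed.

Let half_lt (K j : nat) : (j < 4 * K -> j./2 < 3 * K)%N.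
Proof. clear; lia. Qed.

Let half_end (K j : nat) : (j <= 2 * K -> (j <= 4 * K) && (j./2 <= K))%N.
Proof. clear; lia. Qed.

Let half_mid (K j : nat) : (2 * K <= j <= 4 * K -> [&& j <= 4 * K, K <= j./2 & j./2 <= 2 * K])%N.
Proof. clear; lia. Qed.

Let odd_lt (K j : nat) : odd j -> (j <= 4 * K -> j < 4 * K)%N.
Proof. clear; lia. Qed.

Let even_half (K : nat) : [/\ odd (4 * K) = false, odd (2 * K) = false,
  ((4 * K)./2 = 2 * K)%N & ((2 * K)./2 = K)%N].
Proof. clear; split; lia. Qed.

Let norm_coords (p : R * R) : (`|p.1| <= `|p|) && (`|p.2| <= `|p|).
Proof. by rewrite prod_normE !le_max !lexx orbT. Qed.

Let norm_lt (p : R * R) c : `|p.1| < c -> `|p.2| < c -> `|p| < c.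
Proof. by rewrite prod_normE gt_max => -> ->. Qed.

Lemma plane_grid_drawing : exists K W root, grid_drawing e K W root.
Proof.
have [h [sep h0]] : exists h, separated h /\ 0 < h.
  by apply: (@filter_ex _ (0:R)^'+); apply: filterI; [exact: near_separated|exact: nbhs_right_gt].
(* The side of the squares. Points in the same cell differ by less than m in each coordinate, and W
   may run one sample ahead in the first coordinate of each of the two points: three errors below m
   in all. *)
pose m := h / 3; have m0 : 0 < m by rewrite divr_gt0.
have [d [unif d0]] : exists d, uniform m d /\ 0 < d.
  by apply: (@filter_ex _ (0:R)^'+); apply: filterI; [exact: near_uniform|exact: nbhs_right_gt].
have [M HM] := bounded.
(* K samples per third of an arc. As K exceeds 1/d, consecutive samples are less than m apart. *)
pose K := (Num.truncn d^-1).+1; pose N : R := (3 * K)%:R.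
have K0 : (0 < K)%N by [].
have N0 : 0 < N by rewrite ltr0n muln_gt0.
have KR : 0 < K%:R :> R by rewrite ltr0n.
have Nd : N^-1 < d.
  rewrite -[d]invrK ltf_pV2 ?posrE ?invr_gt0 //.
  have /truncn_itv/andP[_] : 0 <= d^-1 by rewrite invr_ge0 ltW.
  by rewrite -/K /N natrM; lra.
pose g u v (k : nat) := arc u v (k%:R / N).
have k01 (k : nat) : (k <= 3 * K)%N -> `[0, 1]%classic (k%:R / N).
  move=> kN; rewrite /= in_itv /= divr_ge0 ?(ltW N0) //= ler_pdivrMr // mul1r.
  by rewrite ler_nat.
have gstep u v (k : nat) : e u v -> (k < 3 * K)%N ->
    `|(g u v k).1 - (g u v k.+1).1| < m /\ `|(g u v k).2 - (g u v k.+1).2| < m.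
  move=> euv kN.
  have : `|g u v k - g u v k.+1| < m.
    apply: (unif (u, v)) => //; [by apply: k01; apply: ltnW | exact: k01 |].
    by rewrite -natr1 mulrDl mul1r opprD addrA subrr add0r normrN gtr0_norm ?invr_gt0.
  by have /andP[h1 h2] := norm_coords (g u v k - g u v k.+1) => hm; split; exact: le_lt_trans hm.
(* The shift by the bound M keeps the argument nonnegative, where [truncn] is the floor. *)
pose cx (x : R) : nat := Num.truncn ((x + M) / m).
(* Each sample takes two grid steps, the first coordinate moving before the second. Thus the indices
   2K and 4K stand for the parameters 1/3 and 2/3. *)
pose W u v j := if odd j then (cx (g u v j./2.+1).1, cx (g u v j./2).2)
  else (cx (g u v j./2).1, cx (g u v j./2).2).
have gpos u v (k : nat) : e u v -> (k <= 3 * K)%N ->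
    0 <= ((g u v k).1 + M) / m /\ 0 <= ((g u v k).2 + M) / m.
  move=> euv kN; have := HM u v euv _ (k01 k kN); rewrite -/(g u v k) => gM.
  have /andP[h1 h2] := norm_coords (g u v k).
  split; apply: divr_ge0; rewrite ?(ltW m0) //.
    by have := le_trans h1 gM; rewrite ler_norml; lra.
  by have := le_trans h2 gM; rewrite ler_norml; lra.
have diffE (x y : R) : `|(x + M) / m - (y + M) / m| = `|x - y| / m.
  by rewrite -mulrBl normrM [X in _ * X]gtr0_norm ?invr_gt0 //; congr (`|_| / _); lra.
have cx_eq (x y : R) : 0 <= (x + M) / m -> 0 <= (y + M) / m -> cx x = cx y -> `|x - y| < m.
  by move=> hx hy /(truncn_eq_dist hx hy); rewrite diffE ltr_pdivrMr // mul1r.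
have cx_step (x y : R) : 0 <= (x + M) / m -> 0 <= (y + M) / m -> `|x - y| < m ->
    [\/ cx x = cx y, cx x = (cx y).+1 | cx y = (cx x).+1].
  by move=> hx hy xy; apply: truncn_step => //; rewrite diffE ltr_pdivrMr // mul1r.
have W_near u v j : e u v -> (j <= 4 * K)%N -> exists a,
    [/\ (W u v j).1 = cx a, 0 <= (a + M) / m, `|(g u v j./2).1 - a| < m
      & (W u v j).2 = cx (g u v j./2).2].
  move=> euv jK; rewrite /W; case: ifP => oj /=.
    have kK : (j./2.+1 <= 3 * K)%N := half_lt (odd_lt oj jK).
    exists (g u v j./2.+1).1; split=> //; first by have [] := gpos u v _ euv kK.
    by have [] := gstep u v _ euv kK.
  have kK := half_le jK.
  exists (g u v j./2).1; split=> //; first by have [] := gpos u v _ euv kK.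
  by rewrite subrr normr0.
have W_far u v u' v' j j' : e u v -> e u' v' -> (j <= 4 * K)%N -> (j' <= 4 * K)%N ->
    W u v j = W u' v' j' -> `|g u v j./2 - g u' v' j'./2| < h.
  move=> euv euv' jK jK' E.
  have [a [a1 a2 a3 a4]] := W_near u v j euv jK.
  have [b [b1 b2 b3 b4]] := W_near u' v' j' euv' jK'.
  have hm : h = m + m + m by rewrite /m; lra.
  have [_ p2] := gpos u v _ euv (half_le jK).
  have [_ q2] := gpos u' v' _ euv' (half_le jK').
  have ab : `|a - b| < m by apply: cx_eq; rewrite // -a1 -b1 E.
  have cd : `|(g u v j./2).2 - (g u' v' j'./2).2| < m by apply: cx_eq; rewrite // -a4 -b4 E.
  apply: norm_lt => /=; last by lra.
  have := ler_distD a (g u v j./2).1 (g u' v' j'./2).1.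
  have := ler_distD b a (g u' v' j'./2).1; rewrite (distrC b); lra.
have N3 : N = 3 * K%:R by rewrite /N natrM.
have lo (j : nat) : (j <= 2 * K)%N -> `[0, 3^-1]%classic (j./2%:R / N).
  move=> jK; have /andP[_ jh] := half_end jK.
  have jR : (j./2%:R : R) <= K%:R by rewrite ler_nat.
  rewrite /= in_itv /= divr_ge0 ?(ltW N0) //= ler_pdivrMr // N3.
  by lra.
have mid (j : nat) : (2 * K <= j <= 4 * K)%N -> `[3^-1, 2 / 3]%classic (j./2%:R / N).
  move=> jK; have /and3P[_ jh jh'] := half_mid jK.
  have jR : K%:R <= (j./2%:R : R) by rewrite ler_nat.
  have jR' : (j./2%:R : R) <= 2 * K%:R by rewrite -natrM ler_nat.
  rewrite /= in_itv /= ler_pdivlMr // ler_pdivrMr // N3.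
  apply/andP; split; lra.
exists K, W, (fun u => (cx (pos u).1, cx (pos u).2)); split.
- by move=> u v euv; rewrite /W /= /g mul0r arc0.
- move=> u v j euv jK; rewrite /W /= uphalf_half; case: (odd j) (odd_double_half j) => /= jE.
    rewrite add1n; have kK := half_lt jK.
    have [_ p1] := gpos u v _ euv (ltnW kK); have [_ p2] := gpos u v _ euv kK.
    have [_ st] := gstep u v _ euv kK.
    have [->|->|->] := cx_step _ _ p1 p2 st; first by left.
      by right; rewrite /= !eqxx /= !orbT.
    by right; rewrite /= !eqxx /= !orbT.
  rewrite add0n; have kK := half_lt jK.
  have [p1 _] := gpos u v _ euv (ltnW kK); have [p2 _] := gpos u v _ euv kK.
  have [st _] := gstep u v _ euv kK.
  have [->|->|->] := cx_step _ _ p1 p2 st; first by left.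
    by right; rewrite /= !eqxx /= !orbT.
  by right; rewrite /= !eqxx.
- move=> u v euv; rewrite /W.
  have [-> -> -> ->] := even_half K.
  suff -> : g v u K = g u v (2 * K)%N by [].
  rewrite /g (arc_rev euv) ?N3; last first.
    by rewrite divr_ge0 ?mulr_ge0 ?ler0n //= ler_pdivrMr ?mulr_gt0 //; lra.
  congr (arc u v _); rewrite natrM; field; by rewrite gt_eqF.
- move=> u v u' v' j j' euv euv' uu' jK jK'; apply/eqP => E.
  have [s1 _ _] := sep ((u, v), (u', v')) euv euv'.
  have := s1 uu' _ (lo j jK) _ (lo j' jK'); rewrite leNgt => /negP; apply.
  by apply: W_far => //; [case/andP: (half_end jK) | case/andP: (half_end jK')].
- move=> u v u' v' j j' euv euv' u'u u'v jK jK'; apply/eqP => E.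
  have [_ s2 _] := sep ((u, v), (u', v')) euv euv'.
  have := s2 (introT andP (conj u'u u'v)) _ (mid j jK) _ (lo j' jK').
  by rewrite leNgt => /negP; apply; apply: W_far => //;
    [case/and3P: (half_mid jK) | case/andP: (half_end jK')].
move=> u v u' v' j j' euv euv' S jK jK'; apply/eqP => E.
have [_ _ s3] := sep ((u, v), (u', v')) euv euv'.
have := s3 S _ (mid j jK) _ (mid j' jK'); rewrite leNgt => /negP; apply.
by apply: W_far => //; [case/and3P: (half_mid jK) | case/and3P: (half_mid jK')].
Qed.

End Discretize.

Local Close Scope ring_scope.
Local Close Scope classical_set_scope.

(** * The theorem *)

Section MinimalCounterexample.
Variables (V : finType) (e : rel V).
Hypotheses (e_sym : symmetric e) (e_irr : irreflexive e).

(** If y is neither c nor f, the triangle a b y shares only ab with the 5-cycle: along the cycle, a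
    is followed or preceded only by b and f, and b only by a and c. *)
Lemma cycle5_triangle_of_no_tri :
    (forall c t : seq V, is_kcycle e 5 c -> is_kcycle e 3 t ->
       #|cycle_edges c :&: cycle_edges t| <> 1) ->
  forall a b c d f y, uniq [:: a; b; c; d; f] ->
    e a b -> e b c -> e c d -> e d f -> e f a -> e a y -> e b y -> y = c \/ y = f.
Proof.
move=> no_tri a b c d f y u ab bc cd df fa ay by_.
apply: contrapT => /not_orP[/eqP yc /eqP yf].
have neq x z : e x z -> x != z by apply: contraTneq => ->; rewrite e_irr.
have ay' := neq _ _ ay; have by' := neq _ _ by_; have ab' := neq _ _ ab.
have ut : uniq [:: a; b; y] by rewrite /= !inE !negb_or ab' ay' by'.
apply: (no_tri [:: a; b; c; d; f] [:: a; b; y]).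
- by rewrite /is_kcycle /ucycleb u /= ab bc cd df fa.
- by rewrite /is_kcycle /ucycleb ut /= ab by_ e_sym ay.
have nt : [/\ next [:: a; b; y] a = b, next [:: a; b; y] b = y & next [:: a; b; y] y = a].
  by rewrite /= !eqxx (eq_sym b a) (eq_sym y a) (eq_sym y b) (negbTE ab') (negbTE ay') (negbTE by').
have [n1 n2 n3 n4 n5] := next_cycle5 u.
have [t1 t2 t3] := nt.
apply/eqP/cards1P; exists [set a; b]; apply/setP => E; rewrite !inE.
have noeq (p q r s : V) : [set p; q] = [set r; s] -> (r \in [:: p; q]) && (s \in [:: p; q]).
  by move=> /setP E2; have := E2 r; have := E2 s; rewrite !inE !eqxx orbT /= => -> ->.
apply/andP/eqP => [[/imsetP[x xc ->] /imsetP[z zt]]|->]; last first.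
  by split; apply/imsetP; exists a; rewrite ?inE ?eqxx // ?n1 ?t1.
have neqC (p q : V) : p != q -> ((p == q) = false) * ((q == p) = false).
  by move=> pq; rewrite (eq_sym q) (negbTE pq).
rewrite /= !inE !negb_or in u.
case/and5P: u => [/and4P[_ /neqC ac /neqC ad /neqC af]
  /and3P[/neqC bc' /neqC bd /neqC bf] /andP[/neqC cd' /neqC cf] /neqC df' _].
have {}ab' := neqC _ _ ab'; have {}ay' := neqC _ _ ay'; have {}by' := neqC _ _ by'.
have {}yc := neqC _ _ yc; have {}yf := neqC _ _ yf.
move: xc zt; rewrite !in_cons !in_nil !orbF.
by case/or4P=> [/eqP->|/eqP->|/eqP->|/orP[]/eqP->]; case/or3P=> /eqP->;
  rewrite ?n1 ?n2 ?n3 ?n4 ?n5 ?t1 ?t2 ?t3 // => /noeq;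
  rewrite !inE; rewrite !(eqxx, ab', ac, ad, af, bc', bd, bf, cd', cf, df', ay', by', yc, yf) /= ?andbF.
Qed.

End MinimalCounterexample.

(** By induction on the size of S, all smaller sets are colourable. If S were not, the graph induced
    on it would be vertex-critical and inherit the drawing, contradicting [no_critical_graph]. *)
Lemma colorable_of_grid_drawing (V : finType) (e : rel V) (C : finType) (L : V -> {set C})
    K W root :
  symmetric e -> irreflexive e -> (forall v, #|L v| = 4) -> grid_drawing e K W root ->
  (forall a b c d f y, uniq [:: a; b; c; d; f] ->
    e a b -> e b c -> e c d -> e d f -> e f a -> e a y -> e b y -> y = c \/ y = f) ->
  forall S : {set V}, colorable_on e L S.
Proof.
move=> e_sym e_irr L4 drawing cyc S.
have [n] := ubnP #|S|; elim: n S => // n IHn S leSn; apply: contrapT => not_col.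
have pick_color v : exists x, x \in L v by apply/card_gt0P; rewrite L4.
pose c0 v := xchoose (pick_color v).
pose e' (u v : {x | x \in S}) := e (val u) (val v).
have e'_sym : symmetric e' by move=> u v; apply: e_sym.
have e'_irr : irreflexive e' by move=> u; apply: e_irr.
have [rot [rot_uniq rot_mem hom]] :=
  grid_drawing_rotation e'_sym e'_irr (grid_drawing_sub S drawing).
apply: (@no_critical_graph _ e' C (fun v => L (val v)) e'_sym e'_irr _ _ _ rot) => //.
- move=> [c [cL cP]]; apply: not_col.
  exists (fun v => if insub v is Some v' then c v' else c0 v); split.
    by move=> v vS; rewrite insubT; have := cL (Sub v vS); rewrite inE SubK => /(_ isT).
  move=> u v uS vS euv; rewrite !insubT.
  by apply: cP; rewrite ?inE.
- move=> W' W'T; have [|c [cL cP]] := IHn (val @: W').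
    rewrite -ltnS (leq_trans _ leSn) // ltnS card_imset; last exact: val_inj.
    rewrite -[#|S|]card_sig -cardsT; apply: proper_card.
    by rewrite finset.properEneq W'T finset.subsetT.
  exists (fun v => c (val v)); split.
    by move=> v vW; apply: cL; apply: imset_f.
  by move=> u v uW vW; apply: cP; apply: imset_f.
- move=> a b c d f y u ab bc cd df fa ay by_.
  have vu : uniq [:: val a; val b; val c; val d; val f].
    by rewrite -[X in uniq X]/(map val [:: a; b; c; d; f]) (map_inj_uniq val_inj).
  by have [/val_inj|/val_inj] := cyc _ _ _ _ _ (val y) vu ab bc cd df fa ay by_;
    [left | right].
Qed.

Theorem theorem1 (R : realType) (V : finType) (e : rel V)
    (e_sym : symmetric e) (e_irr : irreflexive e)
    (e_planar : planar R e)
    (no_wheel : forall c : seq V, is_kcycle e 5 c -> ~ in_wheel5 e c)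
    (no_tri : forall c t : seq V, is_kcycle e 5 c -> is_kcycle e 3 t ->
       #|cycle_edges c :&: cycle_edges t| <> 1) :
  choosable e 4.
Proof.
move=> C L L4; have [pos [arc drawing]] := e_planar.
have [K [W [root gd]]] := plane_grid_drawing drawing.
have [c [cL cP]] := colorable_of_grid_drawing e_sym e_irr L4 gd
  (cycle5_triangle_of_no_tri e_sym e_irr no_tri) [set: V]%SET.
exists c; split=> [v|u v euv]; first by apply: cL; rewrite inE.
by apply/eqP; apply: cP; rewrite ?inE.
Qed.
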